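(* Let $\Omega\subset\mathbb{R}^2$ be a compact convex set with non-empty interior whose minimal unfolded region $uf(\Omega)$ is contained in the interior of $\Omega$. If $$0<h\le\sqrt{2}\,\min\{|z-w|: z\in uf(\Omega),\ w\in\partial\Omega\},$$ then $\Omega$ has a unique solid angle center of height $h$.
   Context: $A_\Omega^{(h)}(x)=\int_\Omega \frac{h}{(|y-x|^2+h^2)^{3/2}}\,dy$; a solid angle center of height $h$ is a maximizer of $A_\Omega^{(h)}$ over $\mathbb{R}^2$. Minimal unfolded region: for $v\in S^1$ and $c\in\mathbb{R}$ let $I_{v,c}$ be the reflection in the line $\{z: z\cdot v=c\}$, $\Omega^+_{v,a}=\Omega\cap\{z\cdot v\ge a\}$, $\Omega^-_{v,a}=\Omega\cap\{z\cdot v\le a\}$, $u(v)=\inf\{b: I_{v,c}(\Omega^+_{v,c})\subset\Omega\ \forall c\ge b\}$, $l(v)=\sup\{b: I_{v,c}(\Omega^-_{v,c})\subset\Omega\ \forall c\le b\}$, and $uf(\Omega)=\bigcap_{v\in S^1}\{z\in\mathbb{R}^2: l(v)\le z\cdot v\le u(v)\}$. *)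

(* Defs.v *)
From Stdlib Require Import Reals Lra ClassicalEpsilon.
Open Scope R_scope.

Definition pt : Type := (R * R)%type.

Definition dot (z w : pt) : R := fst z * fst w + snd z * snd w.
Definition sqdist (z w : pt) : R := (fst z - fst w)^2 + (snd z - snd w)^2.
Definition dist2 (z w : pt) : R := sqrt (sqdist z w).
Definition unit_vec (v : pt) : Prop := dot v v = 1.

Definition interior2 (Om : pt -> Prop) (x : pt) : Prop :=
  exists eps, 0 < eps /\ forall y, dist2 x y < eps -> Om y.
Definition boundary2 (Om : pt -> Prop) (w : pt) : Prop :=
  forall eps, 0 < eps ->
    (exists p, Om p /\ dist2 w p < eps) /\ (exists q, ~ Om q /\ dist2 w q < eps).
Definition closed_set2 (Om : pt -> Prop) : Prop :=
  forall x, (forall eps, 0 < eps -> exists y, Om y /\ dist2 x y < eps) -> Om x.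
Definition bounded_set2 (Om : pt -> Prop) : Prop :=
  exists M, forall x, Om x -> dist2 x (0,0) <= M.
Definition compact_set2 (Om : pt -> Prop) : Prop := closed_set2 Om /\ bounded_set2 Om.
Definition convex_set (Om : pt -> Prop) : Prop :=
  forall x y t, Om x -> Om y -> 0 <= t <= 1 ->
    Om ((1 - t) * fst x + t * fst y, (1 - t) * snd x + t * snd y).

(* Reflection I_{v,c} in the line {z : z.v = c} (v a unit vector) *)
Definition refl (v : pt) (c : R) (z : pt) : pt :=
  (fst z - 2 * (dot z v - c) * fst v, snd z - 2 * (dot z v - c) * snd v).

Definition upper_ok (Om : pt -> Prop) (v : pt) (b : R) : Prop :=
  forall c, c >= b -> forall z, Om z -> dot z v >= c -> Om (refl v c z).
Definition lower_ok (Om : pt -> Prop) (v : pt) (b : R) : Prop :=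
  forall c, c <= b -> forall z, Om z -> dot z v <= c -> Om (refl v c z).

(* u(v) = inf {b | upper_ok b}, l(v) = sup {b | lower_ok b};
   z.v <= u(v) iff z.v is a lower bound of that set, and dually. *)
Definition unfolded_region (Om : pt -> Prop) (z : pt) : Prop :=
  forall v, unit_vec v ->
    (forall b, upper_ok Om v b -> dot z v <= b) /\
    (forall b, lower_ok Om v b -> b <= dot z v).

Definition sa_kernel (h : R) (x y : pt) : R :=
  h / Rpower (sqdist y x + h ^ 2) (3 / 2).

Definition indic (Om : pt -> Prop) (p : pt) : R :=
  if excluded_middle_informative (Om p) then 1 else 0.

(* Riemann sum of (indicator of Om) * F on the grid (1/m) Z^2 restricted to
   [-m, m]^2, with m = n + 1. *)
Definition grid_sum (Om : pt -> Prop) (F : pt -> R) (n : nat) : R :=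
  let m := S n in
  sum_f_R0 (fun a =>
    sum_f_R0 (fun b =>
      let p := ((INR a - INR (m * m)) / INR m, (INR b - INR (m * m)) / INR m) in
      indic Om p * F p / (INR m * INR m)) (2 * m * m)%nat) (2 * m * m)%nat.

(* integral_over Om F I : the integral of F over Om equals I,
   defined as the limit of the grid Riemann sums (valid for bounded
   Jordan-measurable Om, e.g. compact convex, and bounded continuous F). *)
Definition integral_over (Om : pt -> Prop) (F : pt -> R) (I : R) : Prop :=
  Un_cv (grid_sum Om F) I.

Definition solid_angle (Om : pt -> Prop) (h : R) (x : pt) (a : R) : Prop :=
  integral_over Om (sa_kernel h x) a.

Definition solid_angle_center (Om : pt -> Prop) (h : R) (x : pt) : Prop :=
  exists a : R, solid_angle Om h x a /\
    forall (y : pt) (b : R), solid_angle Om h y b -> b <= a.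

(* Main.v *)
(** In polar coordinates around [x], with [rho x d] the distance from [x] to the
    boundary in the direction [d], the solid angle is the integral over [d] of
    [1 - h / sqrt (rho x d ^ 2 + h ^ 2)].  This integrand is an increasing and
    strictly concave function of [rho] for [rho >= h / sqrt 2], and [rho x d] is
    concave in [x] because [Om] is convex; hence the solid angle is strictly
    midpoint concave at pairs of points whose distance to the boundary is at
    least [h / sqrt 2].  Every maximizer is such a point: if [x] lies strictly
    beyond a line across which [Om] folds into itself, then reflecting [x] in a
    nearby parallel line strictly increases the solid angle, so maximizers lie
    in the minimal unfolded region.  A maximizer exists because the solid angle
    is Lipschitz and increases when [x] is clamped to a square containing [Om].
    The grid sums converge to the Lebesgue integral by dominated convergence,
    since the boundary of a convex set is a null set.  Directions are
    parametrized by slopes: [y = x + s (1, t)], with Jacobian [|s|]. *)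
From mathcomp Require Import all_boot all_order all_algebra.
From mathcomp Require Import all_classical all_reals all_analysis measurable_realfun.
From mathcomp Require Import ring lra.
Set Implicit Arguments. Unset Strict Implicit. Unset Printing Implicit Defensive.
Import Order.TTheory GRing.Theory Num.Theory.
Import numFieldNormedType.Exports.
Local Open Scope classical_set_scope.
Local Open Scope ring_scope.

(** * Affine substitution on the line *)

Section Affine.
Context {R : realType}.
Local Notation mu := (@lebesgue_measure R).
Local Notation RR := (measurableTypeR R).

(** The bound [h / sqrt 2] is an inflection point: the second derivative of
    [1 - h / sqrt (rho ^ 2 + h ^ 2)] in [rho] is [h (h ^ 2 - 2 rho ^ 2) / (rho ^ 2 + h ^ 2) ^ (5 /
    2)]. Closer to the boundary a ray contributes a convex function of [rho], so concavity is
    available only at points far enough inside; this is why maximizers are located before they are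
    compared. No second derivative is taken: concavity comes from an algebraic comparison of
    [1 / sqrt (rho ^ 2 + h ^ 2)] with its tangent line at the midpoint. A strict inequality between
    integrals needs strictness on a set of positive measure. Both comparisons therefore produce a
    non-empty open set: of points for the reflection, of slopes for the concavity. Slopes replace
    trigonometry. Since [s] takes both signs, one slope carries two opposite rays, and
    [dt / (1 + t ^ 2)] is the angular measure. The balls of [R * R] are squares, so Euclidean discs
    are expressed through squared distances. *)

Lemma measurable_affine (a b : R) :
  measurable_fun [set: RR] ((fun x : R => a * x + b) : RR -> RR).
Proof. by apply: measurable_funD => //; exact: mulrl_measurable. Qed.

Lemma affine_preimage_itv_pos (a b c d : R) : 0 < a ->
  ((fun x : R => a * x + b) @^-1` `]c, d]%classic = `](c - b) / a, (d - b) / a]%classic).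
Proof.
move=> a0; apply/seteqP; split => x /=; rewrite !in_itv /=;
  by rewrite ltr_pdivrMr// ler_pdivlMr// (mulrC x) ltrBlDr lerBrDr.
Qed.

Lemma affine_preimage_itv_neg (a b c d : R) : a < 0 ->
  ((fun x : R => a * x + b) @^-1` `]c, d]%classic = `[(d - b) / a, (c - b) / a[%classic).
Proof.
move=> a0; apply/seteqP; split => x /=; rewrite !in_itv /=;
  by rewrite ler_ndivrMr// ltr_ndivlMr// (mulrC x) ltrBlDr lerBrDr andbC.
Qed.

(** The pushforward of Lebesgue measure, scaled by [|a|], has the right value on half-open
    intervals, hence is Lebesgue measure by uniqueness. *)
Lemma integral_affine (a b : R) (f : R -> \bar R) : a != 0 ->
  measurable_fun [set: RR] f -> (forall x, 0 <= f x)%E ->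
  (`|a|%:E * \int[mu]_x f (a * x + b)%R = \int[mu]_x f x)%E.
Proof.
move=> a0 mf f0.
pose phi := (fun x : R => a * x + b) : RR -> RR.
pose push := measure_function_pushforward__canonical__measure_function_Measure
  mu (measurable_affine a b).
pose nu : {measure set RR -> \bar R} := mscale (NngNum (normr_ge0 a)) push.
have nuE A : measurable A -> mu A = nu A.
  apply: lebesgue_measure_unique => _ [[c d] _ <-].
  rewrite (_ : nu _ =
    (`|a|%:E * mu ((fun x : R => a * x + b)%R @^-1` `]c, d]%classic))%E)//=.
  have [a_gt0|a_lt0|a00] := ltgtP 0 a; last by rewrite -a00 eqxx in a0.
  - rewrite affine_preimage_itv_pos// !lebesgue_measure_itv /= !lte_fin.
    rewrite ltr_pM2r ?invr_gt0// ltrD2r gtr0_norm//.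
    case: ifP => _; last by rewrite mule0.
    by rewrite -!EFinB -EFinM; congr (_%:E); field.
  - rewrite affine_preimage_itv_neg// !lebesgue_measure_itv /= !lte_fin.
    rewrite ltr_nM2r ?invr_lt0// ltrD2r ltr0_norm//.
    case: ifP => _; last by rewrite mule0.
    by rewrite -!EFinB -EFinM; congr (_%:E); field; rewrite lt_eqF.
rewrite [RHS](eq_measure_integral nu); last by move=> A mA _; exact: nuE.
rewrite ge0_integral_mscale//=; congr (_ * _)%E.
by rewrite (ge0_integral_pushforward (measurable_affine a b) mu)//.
Qed.
End Affine.

(** * Affine and polar changes of variables in the plane *)

Section Plane.
Context {R : realType}.
Local Notation mu := (@lebesgue_measure R).
Local Notation RR := (measurableTypeR R).
Local Notation mu2 := (mu \x mu)%E.

Lemma measurable_section1 (f : RR * RR -> \bar R) (x : RR) :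
  measurable_fun [set: RR * RR] f -> measurable_fun [set: RR] (fun y => f (x, y)).
Proof. by move=> mf; exact: measurableT_comp. Qed.

Lemma measurable_section2 (f : RR * RR -> \bar R) (y : RR) :
  measurable_fun [set: RR * RR] f -> measurable_fun [set: RR] (fun x => f (x, y)).
Proof. by move=> mf; exact: measurableT_comp. Qed.

Lemma measurable_affine2 (a b c : R) :
  measurable_fun [set: RR * RR]
    ((fun y => a * y.1 + b * y.2 + c) : RR * RR -> RR).
Proof.
apply: (@measurable_funD _ _ R) => //.
apply: (@measurable_funD _ _ R).
- by apply: (@measurable_funM _ _ R) => //; exact: measurable_fst.
- by apply: (@measurable_funM _ _ R) => //; exact: measurable_snd.
Qed.

Definition affine_map (a b e c d e' : R) (y : RR * RR) : RR * RR :=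
  (a * y.1 + b * y.2 + e, c * y.1 + d * y.2 + e').

Lemma measurable_affine_map a b e c d e' :
  measurable_fun [set: RR * RR] (affine_map a b e c d e').
Proof. by apply: measurable_fun_pair; exact: measurable_affine2. Qed.

Lemma integral_swap (f : RR * RR -> \bar R) :
  measurable_fun [set: RR * RR] f -> (forall y, 0 <= f y)%E ->
  (\int[mu2]_y f (y.2, y.1) = \int[mu2]_y f y)%E.
Proof.
move=> mf f0.
have mswap : measurable_fun [set: RR * RR] (fun y => f (y.2, y.1)).
  apply: (measurableT_comp mf); apply: measurable_fun_pair;
    [exact: measurable_snd|exact: measurable_fst].
by rewrite (fubini_tonelli1 _ mswap)// fubini_tonelli2.
Qed.

(** With pivot [a], the map factors into two triangular maps, each changing a single coordinate,
    with factors [a] and [D / a]. Tonelli reduces each to [integral_affine]. *)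
Lemma integral_affine_map_neq0 a b e c d e' (f : RR * RR -> \bar R) :
  a != 0 -> a * d - b * c != 0 ->
  measurable_fun [set: RR * RR] f -> (forall y, 0 <= f y)%E ->
  (`|a * d - b * c|%:E * \int[mu2]_y f (affine_map a b e c d e' y)
   = \int[mu2]_y f y)%E.
Proof.
move=> a0 D0 mf f0; set D := a * d - b * c.
pose g y := f (affine_map 1 0 0 (c / a) (D / a) (e' - c * e / a) y).
have mg : measurable_fun [set: RR * RR] g.
  by apply: (measurableT_comp mf); exact: measurable_affine_map.
have g0 y : (0 <= g y)%E by exact: f0.
have Da0 : D / a != 0 by rewrite mulf_neq0// invr_eq0.
have -> : (\int[mu2]_y f y = `|D / a|%:E * \int[mu2]_y g y)%E.
  rewrite (fubini_tonelli1 _ mf)// (fubini_tonelli1 _ mg)//.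
  rewrite /fubini_F -ge0_integralZl//; first last.
  - by move=> x _; exact: integral_ge0.
  - exact: measurable_fun_fubini_tonelli_F.
  apply: eq_integral => u _.
  rewrite -(integral_affine (c / a * u + (e' - c * e / a)) Da0)//; last exact: measurable_section1.
  congr (_ * _)%E; apply: eq_integral => y _; rewrite /g /affine_map /=.
  by congr (f (_, _)); ring.
have mfT : measurable_fun [set: RR * RR] (fun y => f (affine_map a b e c d e' y)).
  by apply: (measurableT_comp mf); exact: measurable_affine_map.
have -> : (\int[mu2]_y g y = `|a|%:E * \int[mu2]_y f (affine_map a b e c d e' y))%E.
  rewrite (fubini_tonelli2 _ mfT)// (fubini_tonelli2 _ mg)//.
  rewrite /fubini_G -ge0_integralZl//; first last.
  - by move=> x _; exact: integral_ge0.
  - exact: (measurable_fun_fubini_tonelli_G (fun y => f (affine_map a b e c d e' y))).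
  apply: eq_integral => y _.
  rewrite -(integral_affine (b * y + e) a0)//; last exact: measurable_section2.
  congr (_ * _)%E; apply: eq_integral => x _; rewrite /g /affine_map /=.
  by congr (f (_, _)); rewrite /D; field.
by rewrite muleA -EFinM -normrM divfK.
Qed.

(** When [a = 0], exchanging the two target coordinates makes [c] the pivot. *)
Lemma integral_affine_map a b e c d e' (f : RR * RR -> \bar R) :
  a * d - b * c != 0 ->
  measurable_fun [set: RR * RR] f -> (forall y, 0 <= f y)%E ->
  (`|a * d - b * c|%:E * \int[mu2]_y f (affine_map a b e c d e' y)
   = \int[mu2]_y f y)%E.
Proof.
move=> D0 mf f0; have [a0|a0] := eqVneq a 0; last exact: integral_affine_map_neq0.
have mswap : measurable_fun [set: RR * RR] (fun y => f (y.2, y.1)).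
  apply: (measurableT_comp mf); apply: measurable_fun_pair;
    [exact: measurable_snd|exact: measurable_fst].
have c0 : c != 0 by apply: contraNneq D0 => ->; rewrite a0 mul0r mulr0 subrr.
have D' : c * b - d * a != 0.
  by rewrite (_ : _ - _ = - (a * d - b * c)) ?oppr_eq0//; ring.
have := @integral_affine_map_neq0 c d e' a b e _ c0 D' mswap (fun=> f0 _).
rewrite /= -/(affine_map _ _ _ _ _ _ _) integral_swap// => <-.
by congr (_ * _)%E; rewrite -normrN; congr (`|_|%:E); ring.
Qed.

Lemma measurable_polar (x : RR * RR) (f : RR * RR -> \bar R) :
  measurable_fun [set: RR * RR] f ->
  measurable_fun [set: RR * RR]
    (fun y : RR * RR => (`|y.1|%:E * f ((x.1 + y.1)%R, (x.2 + y.1 * y.2)%R))%E).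
Proof.
move=> mf; apply: emeasurable_funM.
  by apply/measurable_EFinP; apply: measurableT_comp.
apply: (measurableT_comp mf); apply: measurable_fun_pair.
  exact: (@measurable_funD _ _ R).
apply: (@measurable_funD _ _ R) => //; exact: (@measurable_funM _ _ R).
Qed.

(** On the vertical line at abscissa [x.1 + s] with [s != 0], the ordinate is affine in the slope
    [t] with factor [s], so the substitution is one-dimensional. The line [s = 0], where no slope
    exists, is null. *)
Lemma integral_polar (x : RR * RR) (f : RR * RR -> \bar R) :
  measurable_fun [set: RR * RR] f -> (forall y, 0 <= f y)%E ->
  (\int[mu2]_y f y
   = \int[mu]_t \int[mu]_s (`|s|%:E * f ((x.1 + s)%R, (x.2 + s * t)%R)))%E.
Proof.
move=> mf f0.
pose F (y : RR * RR) := (`|y.1|%:E * f ((x.1 + y.1)%R, (x.2 + y.1 * y.2)%R))%E.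
have mF : measurable_fun [set: RR * RR] F by exact: measurable_polar.
have F0 y : (0 <= F y)%E by rewrite mule_ge0.
rewrite -[RHS](fubini_tonelli F)//.
rewrite fubini_tonelli1//.
rewrite -(@integral_affine _ 1 x.1)//; last 2 first.
- exact: measurable_fun_fubini_tonelli_F.
- by move=> y; exact: integral_ge0.
rewrite normr1 mul1e; apply: ge0_ae_eq_integral => //.
- apply: (measurableT_comp (measurable_fun_fubini_tonelli_F f mf f0)).
  exact: measurable_affine.
- exact: measurable_fun_fubini_tonelli_F.
- by move=> y _; exact: integral_ge0.
- by move=> y _; exact: integral_ge0.
exists [set 0]; split => //; first exact: lebesgue_measure_set1.
move=> s /= ns; apply: contrapT => /eqP s0; apply: ns => _.
rewrite /fubini_F -(@integral_affine _ s x.2)//; last exact: measurable_section1.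
rewrite -ge0_integralZl//; last first.
  apply: (measurableT_comp (measurable_section1 _ mf)); exact: measurable_affine.
apply: eq_integral => t _; rewrite /F /=; congr (_ * f (_, _))%E.
  by rewrite mul1r addrC.
by rewrite addrC.
Qed.
End Plane.

(** * Strict monotonicity of the integral *)

Section StrictMono.
Context {R : realType} d (T : measurableType d) (m : {measure set T -> \bar R}).

(** Equal finite integrals would force [g - f] to vanish almost everywhere, whereas it is positive
    on [B]. *)
Lemma ge0_integral_lt (f g : T -> R) (B : set T) :
  measurable_fun [set: T] f -> measurable_fun [set: T] g ->
  (forall x, 0 <= f x) -> (forall x, f x <= g x) ->
  measurable B -> (0 < m B)%E -> (forall x, B x -> f x < g x) ->
  (\int[m]_x (g x)%:E < +oo)%E ->
  (\int[m]_x (f x)%:E < \int[m]_x (g x)%:E)%E.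
Proof.
move=> mf mg f0 fg mB B0 fgB goo.
have mgf : measurable_fun [set: T] (fun x => (g x - f x)%:E).
  by apply/measurable_EFinP; exact: measurable_funB.
have gf0 x : (0 <= (g x - f x)%:E)%E by rewrite lee_fin subr_ge0.
have gE : (\int[m]_x (g x)%:E =
           \int[m]_x (f x)%:E + \int[m]_x (g x - f x)%:E)%E.
  rewrite -ge0_integralD//; last 2 first.
  - by move=> x _; rewrite lee_fin.
  - exact/measurable_EFinP.
  by apply: eq_integral => x _; rewrite -EFinD addrC subrK.
have f_fin : (\int[m]_x (f x)%:E)%E \is a fin_num.
  rewrite ge0_fin_numE; last by apply: integral_ge0 => x _; rewrite lee_fin.
  apply: le_lt_trans goo; apply: ge0_le_integral => //.
  - by move=> x _; rewrite lee_fin.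
  - exact/measurable_EFinP.
  - exact/measurable_EFinP.
  - by move=> x _; rewrite lee_fin.
rewrite gE lteDl// lt_neqAle integral_ge0// andbT eq_sym.
apply/negP => /eqP gf_eq0.
have [N [mN N0 sub]] : ae_eq m setT (fun x => (g x - f x)%:E) (cst 0%E).
  apply/ae_eq_integral_abs => //; rewrite -gf_eq0.
  by apply: eq_integral => x _; rewrite gee0_abs.
have BN : B `<=` N.
  move=> x Bx; apply: sub => /= /(_ I) /eqP; rewrite eqe subr_eq0.
  by move=> /eqP gfx; have := fgB _ Bx; rewrite gfx ltxx.
have : (m B <= m N)%E by apply: le_measure => //; rewrite inE.
by rewrite leNgt N0 B0.
Qed.
End StrictMono.

(** * Open, closed and convex sets of the plane *)

Section PlaneSets.
Context {R : realType}.
Local Notation mu := (@lebesgue_measure R).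
Local Notation RR := (measurableTypeR R).
Local Notation mu2 := (mu \x mu)%E.

(** The product sigma-algebra is built from rectangles, so [U] is written as the countable union of
    the rational squares that it contains. *)
Lemma open2_measurable (U : set (R * R)) :
  open U -> measurable (U : set (RR * RR)).
Proof.
move=> oU.
pose c (q : rat * rat * rat) : R * R := (ratr q.1.1, ratr q.1.2).
pose F (q : rat * rat * rat) : set (RR * RR) :=
  if `[< ball (c q) (ratr q.2) `<=` U >] then
  ball (c q).1 (ratr q.2) `*` ball (c q).2 (ratr q.2) else set0.
rewrite (_ : U = \bigcup_q F q).
  apply: countable_bigcupT_measurable => // q; rewrite /F; case: asboolP => // _.
  by apply: measurableX; exact: measurable_ball.
apply/seteqP; split=> [x Ux|x [q _]]; last first.
  by rewrite /F; case: asboolP => // qU qx; exact: qU.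
have /nbhs_ballP[e /= e0 xeU] : nbhs x U by exact: open_nbhs_nbhs.
(* A centre within [e / 4] of [x] and a radius between [e / 4] and [3 e / 4] give a square that
   contains [x] and stays inside the ball of radius [e]. *)
have e4 : 0 < e / 4 by lra.
have ratP (a : R) : exists q : rat, a - e / 4 < ratr q /\ ratr q < a + e / 4.
  have [|q] := @rat_in_itvoo R (a - e / 4) (a + e / 4); first by lra.
  by rewrite in_itv => /andP; exists q.
have [q1 [q1l q1r]] := ratP x.1.
have [q2 [q2l q2r]] := ratP x.2.
have [q3 [q3l q3r]] := ratP (e / 2).
exists (q1, q2, q3) => //; rewrite /F; case: asboolP => [_|].
  by split; rewrite /= -ball_normE /ball_ /= ltr_norml; apply/andP; split; lra.
case=> y [] /=; rewrite -!ball_normE /ball_ /= !ltr_norml => /andP[? ?] /andP[? ?].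
apply: xeU; split; rewrite -ball_normE /ball_ /= ltr_norml; apply/andP; split; lra.
Qed.

Lemma closed2_measurable (A : set (R * R)) :
  closed A -> measurable (A : set (RR * RR)).
Proof.
by move=> /closed_openC/open2_measurable/measurableC; rewrite setCK.
Qed.

Lemma open2_measure_gt0 (U : set (R * R)) (x : R * R) :
  open U -> U x -> (0 < mu2 (U : set (RR * RR)))%E.
Proof.
move=> oU Ux.
have /nbhs_ballP[e /= e0 xeU] : nbhs x U by exact: open_nbhs_nbhs.
apply: (@lt_le_trans _ _ (mu2 (ball x.1 e `*` ball x.2 e))).
  have mb (z : R) : mu (ball z e) = (e *+ 2)%:E.
    by apply: lebesgue_measure_ball; exact: ltW.
  rewrite product_measure1E; try exact: measurable_ball.
  have -> : (mu (ball x.1 e) * mu (ball x.2 e) = (e *+ 2 * (e *+ 2))%:E)%E.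
    by rewrite EFinM; congr (_ * _)%E; exact: mb.
  by rewrite lte_fin mulr_gt0// pmulrn_lgt0.
apply: le_measure; rewrite ?inE.
- by apply: measurableX; exact: measurable_ball.
- exact: open2_measurable.
- by move=> y [] *; exact: xeU.
Qed.

Definition convex2 (A : set (R * R)) := forall x y t, A x -> A y -> 0 <= t <= 1 ->
  A ((1 - t) * x.1 + t * y.1, (1 - t) * x.2 + t * y.2).

(** The homothety of centre [y] and ratio [1 - t] maps a ball around [x] inside [A] to a ball inside
    [A] around the combination; [w] below is the preimage of [z]. *)
Lemma convex2_interior (A : set (R * R)) x y t : convex2 A ->
  A° x -> A y -> 0 <= t < 1 ->
  A° ((1 - t) * x.1 + t * y.1, (1 - t) * x.2 + t * y.2).
Proof.
move=> cA /nbhs_ballP[e /= e0 xeA] Ay /andP[t0 t1].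
apply/nbhs_ballP; exists ((1 - t) * e) => /=; first by rewrite mulr_gt0// subr_gt0.
have t1' : 0 < 1 - t by rewrite subr_gt0.
move=> z [] /=; rewrite -!ball_normE /ball_ /= => z1 z2.
pose w := ((z.1 - t * y.1) / (1 - t), (z.2 - t * y.2) / (1 - t)).
have -> : z = ((1 - t) * w.1 + t * y.1, (1 - t) * w.2 + t * y.2).
  by rewrite [LHS]surjective_pairing /=; congr (_, _); field; rewrite gt_eqF.
apply: cA => //; last by rewrite t0 ltW.
apply: xeA; split; rewrite -ball_normE /ball_ /=.
- rewrite -(ltr_pM2l t1') -{1}(gtr0_norm t1') -normrM.
  by congr (`|_| < _): z1; field; rewrite gt_eqF.
- rewrite -(ltr_pM2l t1') -{1}(gtr0_norm t1') -normrM.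
  by congr (`|_| < _): z2; field; rewrite gt_eqF.
Qed.
End PlaneSets.

(** * The boundary of a convex set is null *)

Section ConvexBoundary.
Context {R : realType}.
Local Notation mu := (@lebesgue_measure R).
Local Notation RR := (measurableTypeR R).
Local Notation mu2 := (mu \x mu)%E.

Lemma measurable_convex_boundary (A : set (R * R)) :
  closed A -> measurable (A `\` A° : set (RR * RR)).
Proof.
move=> cA; apply: measurableD; first exact: closed2_measurable.
by apply: open2_measurable; exact: open_interior.
Qed.

Definition ray_pt (x : R * R) (t s : R) : R * R := (x.1 + s, x.2 + s * t).

Lemma ray_interior (A : set (R * R)) x t s1 s2 : convex2 A -> A° x ->
  0 < s1 < s2 \/ s2 < s1 < 0 -> A (ray_pt x t s2) -> A° (ray_pt x t s1).
Proof.
move=> cA Ax s12 As2.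
have s20 : s2 != 0 by case: s12 => /andP[]; [move=> *; apply: lt0r_neq0|move=> *; apply: ltr0_neq0]; lra.
rewrite (_ : ray_pt x t s1 = ((1 - s1 / s2) * x.1 + s1 / s2 * (ray_pt x t s2).1,
                              (1 - s1 / s2) * x.2 + s1 / s2 * (ray_pt x t s2).2)); last first.
  by rewrite /ray_pt /=; congr (_, _); field.
apply: convex2_interior => //.
case: s12 => /andP[a b].
  have s2p : 0 < s2 by lra.
  by rewrite divr_ge0 ?ltr_pdivrMr ?mul1r ?ltW.
have s2n : s2 < 0 by lra.
by rewrite ltr_ndivrMr// mul1r a andbT mulr_le0// ?invr_le0 ltW.
Qed.

(* In polar coordinates around an interior point, every line meets the boundary
   in at most two points. *)
Lemma convex_boundary_null (A : set (R * R)) x : closed A -> convex2 A ->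
  A° x -> mu2 (A `\` A° : set (RR * RR)) = 0%E.
Proof.
move=> clA cA Ax; set B := A `\` A°.
have mB : measurable (B : set (RR * RR)) by exact: measurable_convex_boundary.
have -> : mu2 (B : set (RR * RR)) = (\int[mu2]_y (\1_B y)%:E)%E.
  by rewrite integral_indic// setIT.
have mI : measurable_fun [set: RR * RR] (fun y : RR * RR => (\1_B y)%:E : \bar R).
  by apply/measurable_EFinP; exact: measurable_indic.
rewrite (integral_polar x mI); last by move=> y; rewrite lee_fin.
rewrite integral0_eq// => t _.
(* The boundary parameters of either sign, unique if they exist; otherwise the default 0 merely adds
   a point to the exceptional null set. *)
pose a := xget 0 [set s | 0 < s /\ B (ray_pt x t s)].
pose b := xget 0 [set s | s < 0 /\ B (ray_pt x t s)].
have uniq s1 s2 : 0 < s1 < s2 \/ s2 < s1 < 0 ->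
    B (ray_pt x t s1) -> ~ B (ray_pt x t s2).
  by move=> s12 [_ nI] [As2 _]; apply: nI; exact: ray_interior s12 As2.
have Bray s : B (ray_pt x t s) -> s != 0 -> [set a; b] s.
  move=> Bs; rewrite neq_lt => /orP[s0|s0]; [right|left]; apply/esym.
  - rewrite /b; case: xgetP => [_ -> [b0 Bb]|/(_ s)]; last by case.
    case: (ltgtP b s) => // bs; exfalso.
      by apply: (@uniq s b) => //; right; rewrite bs.
    by apply: (@uniq b s) => //; right; rewrite bs.
  - rewrite /a; case: xgetP => [_ -> [a0 Ba]|/(_ s)]; last by case.
    case: (ltgtP a s) => // bs; exfalso.
      by apply: (@uniq a s) => //; left; rewrite a0.
    by apply: (@uniq s a) => //; left; rewrite s0.
have mF : measurable_fun [set: RR] (fun s : RR => (`|s|%:E * (\1_B (ray_pt x t s))%:E)%E).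
  apply: emeasurable_funM; first by apply/measurable_EFinP; exact: normr_measurable.
  apply/measurable_EFinP; apply: measurableT_comp; first exact: measurable_indic.
  apply: measurable_fun_pair; first exact: (@measurable_funD _ _ R).
  by apply: (@measurable_funD _ _ R) => //; exact: (@measurable_funM _ _ R).
transitivity (\int[mu]_(s in [set: RR]) (0 : \bar R))%E; last by rewrite integral0.
apply: ge0_ae_eq_integral => //.
exists [set a; b]; split => //.
- by apply: (@measurableU _ RR); exact: measurable_set1.
- by apply: countable_lebesgue_measure0; apply: finite_set_countable.
- move=> s /= ns; apply: contrapT => nab; apply: ns => _.
  have [->|s0] := eqVneq s 0; first by rewrite normr0 mul0e.
  rewrite indicE memNset ?mule0// => Bs; apply: nab; exact: Bray.
Qed.
End ConvexBoundary.

(** * The kernel and the solid angle as a Lebesgue integral *)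

Section Kernel.
Context {R : realType}.
Local Notation mu := (@lebesgue_measure R).
Local Notation RR := (measurableTypeR R).
Local Notation mu2 := (mu \x mu)%E.
Variable h : R.
Hypothesis h_gt0 : 0 < h.

Definition sq_dist (x y : R * R) : R := (x.1 - y.1) ^+ 2 + (x.2 - y.2) ^+ 2.
Definition profile (q : R) : R := h / (q * Num.sqrt q).
Definition kern (x y : R * R) : R := profile (sq_dist x y + h ^+ 2).

Lemma sq_dist_ge0 x y : 0 <= sq_dist x y.
Proof. by rewrite addr_ge0 ?sqr_ge0. Qed.

Lemma sq_dist_h_gt0 x y : 0 < sq_dist x y + h ^+ 2.
Proof. by rewrite ltr_wpDl ?sq_dist_ge0 ?exprn_gt0. Qed.

Lemma profile_gt0 q : 0 < q -> 0 < profile q.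
Proof. by move=> q0; rewrite divr_gt0// mulr_gt0// sqrtr_gt0. Qed.

Lemma profile_lt p q : 0 < p -> p < q -> profile q < profile p.
Proof.
move=> p0 pq; have q0 : 0 < q by exact: lt_trans pq.
rewrite /profile ltr_pM2l// ltf_pV2 ?posrE ?mulr_gt0 ?sqrtr_gt0//.
by rewrite ltr_pM ?sqrtr_ge0 ?ltr_sqrt// ltW.
Qed.

Lemma profile_le p q : 0 < p -> p <= q -> profile q <= profile p.
Proof.
by move=> p0; rewrite le_eqVlt => /predU1P[->//|pq]; rewrite ltW// profile_lt.
Qed.

Lemma kern_gt0 x y : 0 < kern x y.
Proof. exact: profile_gt0 (sq_dist_h_gt0 x y). Qed.

Lemma kern_le_max x y : kern x y <= profile (h ^+ 2).
Proof. by apply: profile_le; rewrite ?exprn_gt0// lerDr sq_dist_ge0. Qed.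

Lemma measurable_kern x : measurable_fun [set: RR * RR] (kern x : RR * RR -> RR).
Proof.
(* [profile] is decreasing only on positive arguments; truncating at [h ^ 2], below which the
   argument never falls, makes it monotone on the whole line and hence measurable. *)
pose p q := profile (Num.max q (h ^+ 2)).
have mp : measurable_fun [set: RR] (p : RR -> RR).
  apply: nonincreasing_measurable => // q q' qq'; apply: profile_le.
    by rewrite lt_max exprn_gt0// orbT.
  by rewrite ge_max !le_max qq' lexx orbT.
rewrite (_ : kern x = p \o (fun y => sq_dist x y + h ^+ 2)); last first.
  by apply/funext => y; rewrite /p /kern /= max_l// lerDr sq_dist_ge0.
apply: (measurableT_comp mp).
apply: (@measurable_funD _ _ R) => //; apply: (@measurable_funD _ _ R);
  apply: (@measurable_funX _ _ R); apply: (@measurable_funB _ _ R) => //.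
Qed.

Variable A : set (R * R).
Hypothesis clA : closed A.
Variable M : R.
Hypothesis bdA : forall y, A y -> `|y.1| <= M /\ `|y.2| <= M.

Definition integrand x (y : RR * RR) : R := \1_A y * kern x y.
Definition angle x : \bar R := \int[mu2]_y (integrand x y)%:E.

Lemma integrand_ge0 x y : 0 <= integrand x y.
Proof. by rewrite mulr_ge0// ltW// kern_gt0. Qed.

Lemma measurable_integrand x :
  measurable_fun [set: RR * RR] (integrand x : RR * RR -> RR).
Proof.
apply: (@measurable_funM _ _ R); last exact: measurable_kern.
by apply: measurable_indic; exact: closed2_measurable.
Qed.

Lemma square_area_fin (K : R) :
  (mu2 (`[(- K)%R, K]%classic `*` `[(- K)%R, K]%classic : set (RR * RR)) < +oo)%E.
Proof.
rewrite product_measure1E//.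
have mI : (mu `[(- K)%R, K] \is a fin_num).
  rewrite ge0_fin_numE// lebesgue_measure_itv /=; case: ifP => //.
  by rewrite ltry.
by rewrite ltey_eq fin_numM.
Qed.

Lemma area_fin : (mu2 (A : set (RR * RR)) < +oo)%E.
Proof.
apply: le_lt_trans (square_area_fin M); apply: le_measure; rewrite ?inE.
- exact: closed2_measurable.
- exact: measurableX.
- move=> y /bdA[]; rewrite !ler_norml => y1 y2.
  by split; rewrite /= in_itv.
Qed.

Lemma integral_indic_area (C : R) :
  0 <= C -> (\int[mu2]_y (\1_A y * C)%:E = C%:E * mu2 (A : set (RR * RR)))%E.
Proof.
move=> C0.
have mA : measurable (A : set (RR * RR)) by exact: closed2_measurable.
under eq_integral do rewrite mulrC EFinM.
rewrite ge0_integralZl//; last by apply/measurable_EFinP; exact: measurable_indic.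
by rewrite integral_indic// setIT.
Qed.

Lemma angle_ge0 x : (0 <= angle x)%E.
Proof. by apply: integral_ge0 => y _; rewrite lee_fin integrand_ge0. Qed.

Lemma angle_lty x : (angle x < +oo)%E.
Proof.
have C0 : 0 <= profile (h ^+ 2) by rewrite ltW// profile_gt0// exprn_gt0.
apply: (@le_lt_trans _ _ (\int[mu2]_y (\1_A y * profile (h ^+ 2))%:E)%E); last first.
  rewrite integral_indic_area//.
  by rewrite lte_mul_pinfty// area_fin.
apply: ge0_le_integral => //.
- by move=> y _; rewrite lee_fin integrand_ge0.
- by apply/measurable_EFinP; exact: measurable_integrand.
- apply/measurable_EFinP; apply: (@measurable_funM _ _ R) => //.
  by apply: measurable_indic; exact: closed2_measurable.
- by move=> y _; rewrite lee_fin ler_wpM2l// kern_le_max.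
Qed.

Lemma angle_fin x : angle x \is a fin_num.
Proof. by rewrite ge0_fin_numE ?angle_ge0 ?angle_lty. Qed.

End Kernel.

(** * Monotonicity and Lipschitz bound for the solid angle *)

Section Comparison.
Context {R : realType}.
Local Notation mu := (@lebesgue_measure R).
Local Notation RR := (measurableTypeR R).
Local Notation mu2 := (mu \x mu)%E.
Variable h : R.
Hypothesis h_gt0 : 0 < h.
Variable A : set (R * R).
Hypothesis clA : closed A.
Variable M : R.
Hypothesis bdA : forall y, A y -> `|y.1| <= M /\ `|y.2| <= M.
Local Notation angA := (angle h A).
Local Notation kernh := (kern h).

(** The common source of [angle_le], where [C = 0], and of [angle_lipschitz]. *)
Lemma angle_le_scale x x' (C : R) : 0 <= C ->
  (forall y, A y -> kernh x y <= kernh x' y + C) ->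
  (angA x <= angA x' + C%:E * mu2 (A : set (RR * RR)))%E.
Proof.
move=> C0 le_k; have mi x0 := measurable_integrand h_gt0 clA x0.
have mA : measurable_fun [set: RR * RR] (\1_A : RR * RR -> R).
  by apply: measurable_indic; exact: closed2_measurable.
have mAC : measurable_fun [set: RR * RR] (fun y : RR * RR => \1_A y * C).
  exact: (@measurable_funM _ _ R).
have i0 x0 y : [set: RR * RR] y -> (0 <= (integrand h A x0 y)%:E)%E.
  by rewrite lee_fin integrand_ge0.
have mE x0 : measurable_fun [set: RR * RR] (EFin \o integrand h A x0).
  by apply/measurable_EFinP; exact: mi.
have mACE : measurable_fun [set: RR * RR] (fun y : RR * RR => (\1_A y * C)%:E).
  exact/measurable_EFinP.
have AC0 y : [set: RR * RR] y -> (0 <= (\1_A y * C)%:E)%E.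
  by rewrite lee_fin mulr_ge0.
rewrite -(integral_indic_area clA C0) -(ge0_integralD mu2 _ (i0 x') (mE x') AC0 mACE)//.
apply: ge0_le_integral => //.
- by move=> y; exact: i0.
- exact: mE.
- by apply: emeasurable_funD => //; exact: mE.
move=> y _; rewrite -EFinD lee_fin /integrand -mulrDr indicE.
case: (boolP (y \in A)) => [/set_mem Ay|_]; rewrite ?mul0r// !mul1r.
exact: le_k.
Qed.

Lemma angle_le x x' : (forall y, A y -> sq_dist x' y <= sq_dist x y) ->
  (angA x <= angA x')%E.
Proof.
move=> le_d; have := @angle_le_scale x x' 0 (lexx _).
rewrite mul0e adde0; apply => y Ay; rewrite addr0.
by apply: profile_le => //; rewrite ?sq_dist_h_gt0// lerD2r le_d.
Qed.

Lemma abs_le_sqrt_sq_dist x y :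
  `|x.1 - y.1| <= Num.sqrt (sq_dist x y + h ^+ 2) /\
  `|x.2 - y.2| <= Num.sqrt (sq_dist x y + h ^+ 2).
Proof.
by split; rewrite -sqrtr_sqr ler_wsqrtr// /sq_dist;
   [rewrite -addrA lerDl|rewrite addrAC lerDr]; rewrite addr_ge0 ?sqr_ge0.
Qed.

(* With p = sqrt (|x - y|^2 + h^2) and p' likewise,
   kernh x y - kernh x' y = h (p' - p) (p'^2 + p p' + p^2) / (p p')^3,
   and |p - p'| <= |x - x'|_1. *)
Lemma kern_lipschitz x x' y :
  kernh x y <= kernh x' y + 3 / h ^+ 3 * (`|x.1 - x'.1| + `|x.2 - x'.2|).
Proof.
set d := `|_| + _; set q := sq_dist x y + h ^+ 2; set q' := sq_dist x' y + h ^+ 2.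
have q0 : 0 < q by exact: sq_dist_h_gt0.
have q'0 : 0 < q' by exact: sq_dist_h_gt0.
have [px1 px2] := abs_le_sqrt_sq_dist x y.
have [px1' px2'] := abs_le_sqrt_sq_dist x' y.
have pq : Num.sqrt q ^+ 2 = q by rewrite sqr_sqrtr// ltW.
have pq' : Num.sqrt q' ^+ 2 = q' by rewrite sqr_sqrtr// ltW.
have ph : h <= Num.sqrt q.
  by rewrite -[leLHS]gtr0_norm// -sqrtr_sqr ler_wsqrtr// lerDr sq_dist_ge0.
have ph' : h <= Num.sqrt q'.
  by rewrite -[leLHS]gtr0_norm// -sqrtr_sqr ler_wsqrtr// lerDr sq_dist_ge0.
rewrite /kern /profile -/q -/q'.
rewrite -/q in px1 px2; rewrite -/q' in px1' px2'.
move: (Num.sqrt q) (Num.sqrt q') pq pq' ph ph' px1 px2 px1' px2'.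
move=> p p' pq pq' ph ph' px1 px2 px1' px2'.
have p0 : 0 < p by exact: lt_le_trans ph.
have p'0 : 0 < p' by exact: lt_le_trans ph'.
have pd : p' - p <= d.
  (* After multiplication by [p' + p] the left side is a difference of squares, which splits by
     coordinates; each second factor is at most [p' + p] in absolute value. *)
  rewrite -(ler_pM2r (_ : 0 < p' + p)) ?addr_gt0//.
  have -> : (p' - p) * (p' + p) = (x'.1 - x.1) * ((x'.1 - y.1) + (x.1 - y.1)) +
      (x'.2 - x.2) * ((x'.2 - y.2) + (x.2 - y.2)).
    rewrite (_ : (p' - p) * (p' + p) = p' ^+ 2 - p ^+ 2); last by ring.
    by rewrite pq pq' /q /q' /sq_dist; ring.
  rewrite /d [leRHS]mulrDl; apply: lerD; apply: le_trans (ler_norm _) _.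
  - rewrite normrM distrC ler_wpM2l// (le_trans (ler_normD _ _))// lerD//.
  - rewrite normrM distrC ler_wpM2l// (le_trans (ler_normD _ _))// lerD//.
have d0 : 0 <= d by rewrite addr_ge0.
rewrite -pq -pq' -!exprSr.
have [pp'|pp'] := leP p' p.
  apply: (@le_trans _ _ (h / p' ^+ 3)).
    by rewrite ler_pM2l// lef_pV2 ?posrE ?exprn_gt0// lerXn2r// nnegrE ltW.
  by rewrite lerDl mulr_ge0// divr_ge0// exprn_ge0// ltW.
rewrite -lerBlDl.
have -> : h / p ^+ 3 - h / p' ^+ 3 =
    (p' - p) * (h / (p ^+ 3 * p') + h / (p ^+ 2 * p' ^+ 2) + h / (p * p' ^+ 3)).
  by field; rewrite !gt_eqF.
rewrite mulrC; apply: ler_pM => //.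
- by rewrite !addr_ge0// divr_ge0 ?mulr_ge0 ?exprn_ge0// ltW.
- by rewrite subr_ge0 ltW.
(* As [p] and [p'] are at least [h], the three denominators are at least [h ^ 4]; this is the origin
   of the constant [3 / h ^ 3]. *)
have hle (u : R) : h ^+ 4 <= u -> h / u <= 1 / h ^+ 3.
  move=> hu; have h4 : 0 < h ^+ 4 by rewrite exprn_gt0.
  have u0 : 0 < u by exact: lt_le_trans hu.
  by rewrite ler_pdivrMr// mulrAC ler_pdivlMr ?exprn_gt0// mul1r -exprS.
rewrite (_ : 3 / h ^+ 3 = 1 / h ^+ 3 + 1 / h ^+ 3 + 1 / h ^+ 3); last first.
  by field; rewrite gt_eqF.
have hh : 0 <= h by exact: ltW.
have hX n r : h <= r -> h ^+ n <= r ^+ n.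
  by move=> hr; rewrite lerXn2r// nnegrE// (le_trans hh hr).
rewrite !lerD// hle//.
- by rewrite (exprSr h 3) ler_pM ?exprn_ge0// hX.
- by rewrite (exprD h 2 2) ler_pM ?exprn_ge0// hX.
- by rewrite (exprS h 3) ler_pM ?exprn_ge0// hX.
Qed.

Lemma angle_lipschitz x x' :
  (angA x <= angA x' +
   (3 / h ^+ 3 * (`|x.1 - x'.1| + `|x.2 - x'.2|))%:E * mu2 (A : set (RR * RR)))%E.
Proof.
apply: angle_le_scale => [|y _]; last exact: kern_lipschitz.
by rewrite mulr_ge0 ?addr_ge0// divr_ge0// exprn_ge0// ltW.
Qed.
End Comparison.

(** * Reflections strictly increase the solid angle *)

Section Reflection.
Context {R : realType}.
Local Notation mu := (@lebesgue_measure R).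
Local Notation RR := (measurableTypeR R).
Local Notation mu2 := (mu \x mu)%E.

Definition dotp (x y : R * R) : R := x.1 * y.1 + x.2 * y.2.
Definition reflection (v : R * R) (c : R) (z : R * R) : R * R :=
  (z.1 - 2 * (dotp z v - c) * v.1, z.2 - 2 * (dotp z v - c) * v.2).

Lemma dotp_reflection v c z : dotp v v = 1 ->
  dotp (reflection v c z) v - c = - (dotp z v - c).
Proof.
move=> v1; rewrite (_ : dotp (reflection v c z) v =
  dotp z v - 2 * (dotp z v - c) * dotp v v); last by rewrite /reflection /dotp /=; ring.
by rewrite v1; ring.
Qed.

Lemma reflectionK v c : dotp v v = 1 -> involutive (reflection v c).
Proof.
move=> v1 z; rewrite {1}/reflection dotp_reflection// [RHS]surjective_pairing.
by rewrite /reflection /=; congr (_, _); ring.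
Qed.

Lemma reflection_opp v c z :
  reflection (- v.1, - v.2) c z = reflection v (- c) z.
Proof. by rewrite /reflection /dotp /=; congr (_, _); ring. Qed.

(** The sign of the product tells that reflecting [x] brings it closer to [y] exactly when the
    mirror strictly separates them. *)
Lemma sq_dist_reflection v c x y : dotp v v = 1 ->
  sq_dist (reflection v c x) y =
  sq_dist x y + 4 * ((dotp x v - c) * (dotp y v - c)).
Proof.
move=> v1; set a := dotp x v - c.
have -> : sq_dist (reflection v c x) y =
    sq_dist x y - 4 * a * (dotp x v - dotp y v) + 4 * a ^+ 2 * dotp v v.
  by rewrite /sq_dist /reflection -/a /dotp /=; ring.
by rewrite v1 /a; ring.
Qed.

Lemma reflection_affine v c z : reflection v c z =
  affine_map (1 - 2 * v.1 ^+ 2) (- (2 * v.1 * v.2)) (2 * c * v.1)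
             (- (2 * v.1 * v.2)) (1 - 2 * v.2 ^+ 2) (2 * c * v.2) z.
Proof. by rewrite /reflection /affine_map /dotp; congr (_, _); ring. Qed.

Lemma measurable_reflection v c :
  measurable_fun [set: RR * RR] (reflection v c : RR * RR -> RR * RR).
Proof.
rewrite (funext (reflection_affine v c)).
exact: measurable_affine_map.
Qed.

Lemma integral_reflection v c (f : RR * RR -> \bar R) : dotp v v = 1 ->
  measurable_fun [set: RR * RR] f -> (forall y, 0 <= f y)%E ->
  (\int[mu2]_y f (reflection v c y) = \int[mu2]_y f y)%E.
Proof.
move=> v1 mf f0; rewrite -[RHS](@integral_affine_map _
  (1 - 2 * v.1 ^+ 2) (- (2 * v.1 * v.2)) (2 * c * v.1)
  (- (2 * v.1 * v.2)) (1 - 2 * v.2 ^+ 2) (2 * c * v.2))//; last first.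
  rewrite (_ : _ - _ = 1 - 2 * dotp v v); last by rewrite /dotp; ring.
  by rewrite v1; lra.
rewrite (_ : _ - _ = 1 - 2 * dotp v v); last by rewrite /dotp; ring.
rewrite v1 (_ : 1 - 2 * 1 = - 1); last by ring.
rewrite normrN1 mul1e; apply: eq_integral => y _.
by rewrite reflection_affine.
Qed.

Lemma continuous_dotp v : continuous (dotp^~ v : R * R -> R).
Proof.
by move=> z; apply: cvgD; apply: cvgMr_tmp; [exact: cvg_fst|exact: cvg_snd].
Qed.

Lemma continuous_reflection v c : continuous (reflection v c : R * R -> R * R).
Proof.
have cd z : 2 * (dotp x v - c) @[x --> z] --> 2 * (dotp z v - c).
  apply: cvgMl_tmp; apply: cvgB; [exact: continuous_dotp|exact: cvg_cst].
move=> z; apply: (@cvg_pair _ _ _ _ (nbhs (_ : R)) (nbhs (_ : R))) => /=.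
- by apply: cvgB; [exact: cvg_fst|apply: cvgMr_tmp; exact: cd].
- by apply: cvgB; [exact: cvg_snd|apply: cvgMr_tmp; exact: cd].
Qed.

Variable h : R.
Hypothesis h_gt0 : 0 < h.
Variable A : set (R * R).
Hypothesis clA : closed A.
Variable M : R.
Hypothesis bdA : forall y, A y -> `|y.1| <= M /\ `|y.2| <= M.

(** Summing the integrand over the pair [y], [r y] doubles the integral and allows a pointwise
    comparison. If both points lie in [A], passing from [x] to [r x] swaps the two terms. If only
    one does, folding puts it on the far side of the mirror from [x], where [r x] is closer. *)
Lemma angle_lt_reflection v c x y0 : dotp v v = 1 -> c < dotp x v ->
  (forall y, A y -> c <= dotp y v -> A (reflection v c y)) ->
  A° y0 -> ~ A (reflection v c y0) ->
  (angle h A x < angle h A (reflection v c x))%E.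
Proof.
move=> v1 cx fold Ay0 nAy0; set r := reflection v c.
pose phi x y := integrand h A x y + integrand h A x (r y).
have mi z := measurable_integrand h_gt0 clA z.
have mir z : measurable_fun [set: RR * RR] (fun y => integrand h A z (r y)).
  exact: (measurableT_comp (mi z) (measurable_reflection _ _)).
have i0 z y : 0 <= integrand h A z y by exact: integrand_ge0.
have phiE z : (\int[mu2]_y (phi z y)%:E = angle h A z + angle h A z)%E.
  have -> : (\int[mu2]_y (phi z y)%:E =
      \int[mu2]_y (integrand h A z y)%:E + \int[mu2]_y (integrand h A z (r y))%:E)%E.
    rewrite -ge0_integralD//.
    - by move=> y _; rewrite lee_fin.
    - by apply/measurable_EFinP; exact: mi.
    - by move=> y _; rewrite lee_fin.
    - by apply/measurable_EFinP; exact: mir.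
  congr (_ + _)%E.
  rewrite /r (@integral_reflection v c (fun y => (integrand h A z y)%:E))//.
    by apply/measurable_EFinP; exact: mi.
  by move=> y; rewrite lee_fin.
(* The unpaired points in the interior of [A]: an open set containing [y0], hence of positive
   measure, where the comparison is strict. *)
pose U := A° `&` r @^-1` (~` A).
have oU : open U.
  apply: openI; first exact: open_interior.
  apply: open_comp; last by rewrite openC.
  by move=> y _; exact: continuous_reflection.
have fin z := @angle_fin _ _ h_gt0 _ clA _ bdA z.
have q_gt0 z y := @sq_dist_h_gt0 _ _ h_gt0 z y.
have kE y : kern h (r x) y =
    profile h (sq_dist x y + h ^+ 2 + 4 * ((dotp x v - c) * (dotp y v - c))).
  by rewrite /kern /r sq_dist_reflection// addrAC.
have rr y : r (r y) = y by exact: reflectionK.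
have krr y : kern h (r x) (r y) = kern h x y.
  rewrite /kern /r sq_dist_reflection// [in LHS](_ : sq_dist x _ = sq_dist (reflection v c y) x); last first.
    by rewrite /sq_dist; ring.
  rewrite sq_dist_reflection// dotp_reflection//.
  by congr (profile h (_ + _)); rewrite /sq_dist; ring.
have kr y : kern h x (r y) = kern h (r x) y by rewrite -{2}(rr y) krr.
have k_lt y : dotp y v < c -> kern h x y < kern h (r x) y.
  move=> yc; have := q_gt0 (r x) y; rewrite /r sq_dist_reflection// addrAC.
  rewrite kE => q0; apply: profile_lt => //.
  by rewrite gtrDl pmulr_rlt0// pmulr_rlt0 ?subr_gt0// subr_lt0.
have k_ge y : c <= dotp y v -> kern h (r x) y <= kern h x y.
  move=> yc; rewrite kE; apply: profile_le => //.
  by rewrite lerDl mulr_ge0// mulr_ge0// subr_ge0// ltW.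
have fold' y : dotp y v < c -> A (r y) -> A y.
  move=> yc Ary; rewrite -(rr y); apply: fold => //.
  by rewrite -subr_ge0 dotp_reflection// oppr_ge0 subr_le0 ltW.
have : (\int[mu2]_y (phi x y)%:E < \int[mu2]_y (phi (r x) y)%:E)%E.
  apply: (@ge0_integral_lt _ _ _ _ _ _ (U : set (RR * RR))).
  - by apply: (@measurable_funD _ _ R); [exact: mi|exact: mir].
  - by apply: (@measurable_funD _ _ R); [exact: mi|exact: mir].
  - by move=> y; rewrite addr_ge0.
  - move=> y; rewrite /phi /integrand krr kr !indicE.
    have [yc|yc] := ltP (dotp y v) c.
      have kl := ltW (k_lt _ yc).
      have [/set_mem/(fold' _ yc) Ay|_] := boolP (r y \in A).
        by rewrite (mem_set Ay) !mul1r addrC.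
      by rewrite !mul0r !addr0 ler_wpM2l.
    have kl := k_ge _ yc.
    have [/set_mem Ay|_] := boolP (y \in A).
      by rewrite (mem_set (fold _ Ay yc)) !mul1r addrC.
    by rewrite !mul0r !add0r ler_wpM2l.
  - exact: open2_measurable.
  - exact: (open2_measure_gt0 oU (x := y0)).
  - move=> y [/interior_subset Ay nAry]; rewrite /phi /integrand krr kr !indicE.
    rewrite (mem_set Ay) (memNset nAry) !mul1r !mul0r !addr0.
    have [yc|yc] := ltP (dotp y v) c; first exact: k_lt.
    by case: nAry; exact: fold.
  - by rewrite phiE; apply: lte_add_pinfty; exact: (angle_lty h_gt0 clA bdA).
rewrite !phiE -(fineK (fin x)) -(fineK (fin (r x))) -!EFinD !lte_fin.
by move=> lt; lra.
Qed.
End Reflection.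

(** * Strict concavity of the radial profile *)

Section RadialProfile.
Context {R : realType}.
Local Notation mu := (@lebesgue_measure R).
Local Notation RR := (measurableTypeR R).
Variable h : R.
Hypothesis h_gt0 : 0 < h.

(* [E] is concave in [u] and, when [u < 0], concave in [H]; each identity below
   interpolates it between the end points of the admissible interval. *)
Lemma tangent_discriminant_gt0 (a m H : R) : 0 < H -> 0 < a -> 0 < m ->
  H <= 2 * a ^+ 2 -> H < 2 * m ^+ 2 -> m * (a - m) < m ^+ 2 + H ->
  0 < (m ^+ 2 + H) * (2 * m ^+ 2 - H) + m * (a - m) * (2 * H - m * (a - m)).
Proof.
move=> H0 a0 m0 Ha Hm uQ; set E := _ + _.
have [u0|u0] := leP 0 (m * (a - m)).
  have -> : E = (m ^+ 2 + H - m * (a - m)) * (2 * m ^+ 2 - H) +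
      m * (a - m) * m ^+ 2 + m * (a - m) * (m ^+ 2 + H - m * (a - m)).
    by rewrite /E; ring.
  have Q0 : 0 < m ^+ 2 + H - m * (a - m) by rewrite subr_gt0.
  rewrite -addrA ltr_pwDl// ?mulr_gt0 ?subr_gt0//.
  by rewrite addr_ge0// mulr_ge0// ?exprn_ge0 ?ltW.
have am : a < m by move: u0; rewrite pmulr_rlt0// subr_lt0.
have a2 : 0 < 2 * a ^+ 2 by rewrite mulr_gt0// exprn_gt0.
rewrite -(pmulr_rgt0 _ a2).
have -> : 2 * a ^+ 2 * E =
    (2 * a ^+ 2 - H) * (m ^+ 2 * (m ^+ 2 + a * (2 * m - a))) +
    H * ((m - a) * (m ^+ 3 + 3 * m ^+ 2 * a + 4 * a ^+ 3)) +
    2 * a ^+ 2 * (H * (2 * a ^+ 2 - H)).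
  by rewrite /E; ring.
have Ha' : 0 <= 2 * a ^+ 2 - H by rewrite subr_ge0.
have ma : 0 < m - a by rewrite subr_gt0.
have m3 : 0 < m ^+ 3 by rewrite exprn_gt0.
have m2 : 0 < m ^+ 2 by rewrite exprn_gt0.
have a3 : 0 < a ^+ 3 by rewrite exprn_gt0.
rewrite ltr_pwDl ?ltr_wpDl//.
- rewrite mulr_ge0// mulr_ge0 ?(ltW m2)// addr_ge0 ?(ltW m2)//.
  by rewrite mulr_ge0; lra.
- rewrite !mulr_gt0// !addr_gt0// ?mulr_gt0//.
- by rewrite !mulr_ge0// ltW.
Qed.

(** The left side is the tangent line at [m] of [1 / sqrt (rho ^ 2 + h ^ 2)], evaluated at [a]. A
    non-positive numerator is harmless; otherwise, clearing denominators and squaring leaves a gap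
    equal to [(a - m) ^ 2] times the polynomial of [tangent_discriminant_gt0]. *)
Lemma tangent_line_lt (a m : R) : 0 < a -> 0 < m -> a != m ->
  h ^+ 2 <= 2 * a ^+ 2 -> h ^+ 2 < 2 * m ^+ 2 ->
  (m ^+ 2 + h ^+ 2 - m * (a - m)) / Num.sqrt (m ^+ 2 + h ^+ 2) ^+ 3 <
  (Num.sqrt (a ^+ 2 + h ^+ 2))^-1.
Proof.
move=> a0 m0 am Ha Hm.
have h2 : 0 < h ^+ 2 by rewrite exprn_gt0.
have P0 : 0 < a ^+ 2 + h ^+ 2 by rewrite addr_gt0// exprn_gt0.
have Q0 : 0 < m ^+ 2 + h ^+ 2 by rewrite addr_gt0// exprn_gt0.
have pP : Num.sqrt (a ^+ 2 + h ^+ 2) ^+ 2 = a ^+ 2 + h ^+ 2 by rewrite sqr_sqrtr// ltW.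
have qQ : Num.sqrt (m ^+ 2 + h ^+ 2) ^+ 2 = m ^+ 2 + h ^+ 2 by rewrite sqr_sqrtr// ltW.
have p0 : 0 < Num.sqrt (a ^+ 2 + h ^+ 2) by rewrite sqrtr_gt0.
have q0 : 0 < Num.sqrt (m ^+ 2 + h ^+ 2) by rewrite sqrtr_gt0.
move: (Num.sqrt (a ^+ 2 + h ^+ 2)) (Num.sqrt (m ^+ 2 + h ^+ 2)) pP qQ p0 q0.
move=> p q pP qQ p0 q0.
have q3 : 0 < q ^+ 3 by rewrite exprn_gt0.
rewrite ltr_pdivrMr// [ltRHS]mulrC ltr_pdivlMr//.
have [Qu|Qu] := leP (m ^+ 2 + h ^+ 2) (m * (a - m)).
  apply: le_lt_trans q3; rewrite pmulr_lle0// subr_le0//.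
have E0 := tangent_discriminant_gt0 h2 a0 m0 Ha Hm Qu.
have d0 : 0 < (a - m) ^+ 2 by rewrite exprn_even_gt0//= subr_eq0.
rewrite -(@ltr_pXn2r _ 2)// ?nnegrE ?mulr_ge0 ?subr_ge0 ?(ltW Qu) ?(ltW p0) ?(ltW q3) ?(ltW q0)//.
rewrite exprMn pP -exprM (exprM q 2 3) qQ -subr_gt0.
rewrite (_ : _ - _ = (a - m) ^+ 2 * ((m ^+ 2 + h ^+ 2) * (2 * m ^+ 2 - h ^+ 2) +
   m * (a - m) * (2 * h ^+ 2 - m * (a - m)))); last by ring.
exact: mulr_gt0.
Qed.

(** The tangent line at the midpoint lies below the function at both [a] and [b]; in the sum the
    slope terms cancel. *)
Lemma inv_sqrt_midpoint_lt (a b : R) : 0 < a -> 0 < b -> a != b ->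
  h ^+ 2 <= 2 * a ^+ 2 -> h ^+ 2 <= 2 * b ^+ 2 ->
  2 / Num.sqrt (((a + b) / 2) ^+ 2 + h ^+ 2) <
  (Num.sqrt (a ^+ 2 + h ^+ 2))^-1 + (Num.sqrt (b ^+ 2 + h ^+ 2))^-1.
Proof.
move=> a0 b0 ab Ha Hb; set m := (a + b) / 2.
have m0 : 0 < m by rewrite divr_gt0// addr_gt0.
have h2 : 0 < h ^+ 2 by rewrite exprn_gt0.
(* The product [a b] inherits the bound as a geometric mean; since [2 m ^ 2] exceeds [2 a b] by
   [(a - b) ^ 2 / 2], the tangent point satisfies it strictly. *)
have habs : h ^+ 2 <= 2 * (a * b).
  have ab0 : 0 <= 2 * (a * b) by rewrite !mulr_ge0// ltW.
  rewrite -(@ler_pXn2r _ 2)// ?nnegrE ?(ltW h2)//.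
  rewrite [leRHS](_ : _ = (2 * a ^+ 2) * (2 * b ^+ 2)); last by ring.
  by rewrite expr2 ler_pM// ltW.
have Hm : h ^+ 2 < 2 * m ^+ 2.
  have d0 : 0 < (a - b) ^+ 2 by rewrite exprn_even_gt0//= subr_eq0.
  have -> : 2 * m ^+ 2 = (a - b) ^+ 2 / 2 + 2 * (a * b) by rewrite /m; field.
  by apply: le_lt_trans habs _; rewrite ltrDr divr_gt0.
have am : a != m.
  rewrite -subr_eq0 (_ : a - m = (a - b) / 2); last by rewrite /m; field.
  by rewrite mulf_neq0// subr_eq0.
have bm : b != m.
  rewrite -subr_eq0 (_ : b - m = (b - a) / 2); last by rewrite /m; field.
  by rewrite mulf_neq0// subr_eq0 eq_sym.
have := ltrD (tangent_line_lt a0 m0 am Ha Hm) (tangent_line_lt b0 m0 bm Hb Hm).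
apply: le_lt_trans; rewrite -mulrDl.
have Q0 : 0 < m ^+ 2 + h ^+ 2 by rewrite addr_gt0// exprn_gt0.
have q0 : 0 < Num.sqrt (m ^+ 2 + h ^+ 2) by rewrite sqrtr_gt0.
have qQ : Num.sqrt (m ^+ 2 + h ^+ 2) ^+ 2 = m ^+ 2 + h ^+ 2 by rewrite sqr_sqrtr// ltW.
have -> : m ^+ 2 + h ^+ 2 - m * (a - m) + (m ^+ 2 + h ^+ 2 - m * (b - m)) =
    2 * (m ^+ 2 + h ^+ 2) by rewrite /m; field.
move: (Num.sqrt (m ^+ 2 + h ^+ 2)) q0 qQ => q q0 qQ.
by rewrite -qQ le_eqVlt; apply/orP; left; apply/eqP; field; rewrite gt_eqF.
Qed.

(** For [T = 1 + t ^ 2], the squared length of the direction [(1, t)], parameter [b] lies at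
    distance [sqrt T * b], and [1 / T] is the derivative of the polar angle with respect to the
    slope. *)
Definition radial_primitive (T b : R) : R := T^-1 * (1 - h / Num.sqrt (T * b ^+ 2 + h ^+ 2)).

Lemma radial_primitive_le T b b' : 0 < T -> 0 <= b -> b <= b' ->
  radial_primitive T b <= radial_primitive T b'.
Proof.
move=> T0 b0 bb'; rewrite /radial_primitive ler_pM2l ?invr_gt0// lerD2l lerN2.
have h2 : 0 < h ^+ 2 by rewrite exprn_gt0.
have b0' : 0 <= b' by exact: le_trans bb'.
have Tb : 0 <= T * b ^+ 2 by rewrite mulr_ge0 ?(ltW T0) ?sqr_ge0.
have Tb' : 0 <= T * b' ^+ 2 by rewrite mulr_ge0 ?(ltW T0) ?sqr_ge0.
rewrite ler_pM2l// lef_pV2 ?posrE ?sqrtr_gt0 ?ltr_wpDl// ler_wsqrtr//.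
by rewrite lerD2r ler_pM2l// lerXn2r.
Qed.

(** Scaling by [sqrt T] turns parameters into distances and reduces to [inv_sqrt_midpoint_lt];
    monotonicity then passes from the midpoint to any larger [m]. *)
Lemma radial_primitive_midpoint_lt T a b m : 0 < T -> 0 < a -> 0 < b -> a != b ->
  h ^+ 2 <= 2 * (T * a ^+ 2) -> h ^+ 2 <= 2 * (T * b ^+ 2) -> (a + b) / 2 <= m ->
  radial_primitive T a + radial_primitive T b < 2 * radial_primitive T m.
Proof.
move=> T0 a0 b0 ab Ha Hb abm.
have rT : 0 < Num.sqrt T by rewrite sqrtr_gt0.
have rTE z : T * z ^+ 2 = (Num.sqrt T * z) ^+ 2 by rewrite exprMn sqr_sqrtr// ltW.
have ab0 : 0 <= (a + b) / 2 by rewrite divr_ge0// addr_ge0// ltW.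
have : 2 * radial_primitive T ((a + b) / 2) <= 2 * radial_primitive T m.
  by rewrite ler_pM2l// radial_primitive_le.
apply: lt_le_trans; rewrite /radial_primitive -[ltLHS]mulrDr [ltRHS]mulrCA ltr_pM2l ?invr_gt0//.
rewrite (rTE ((a + b) / 2)) (_ : Num.sqrt T * ((a + b) / 2) = (Num.sqrt T * a + Num.sqrt T * b) / 2); last by field.
have := @inv_sqrt_midpoint_lt (Num.sqrt T * a) (Num.sqrt T * b).
rewrite -!rTE !mulr_gt0// => /(_ isT isT).
have -> : Num.sqrt T * a != Num.sqrt T * b.
  by apply: contraNneq ab => /(mulfI (lt0r_neq0 rT)) ->.
move=> /(_ isT Ha Hb) lt.
rewrite -(ltr_pM2l h_gt0) mulrDr in lt.
by lra.
Qed.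
End RadialProfile.

(** * Integration of the kernel along a line *)

Section RadialIntegral.
Context {R : realType}.
Local Notation mu := (@lebesgue_measure R).
Local Notation RR := (measurableTypeR R).
Variable h : R.
Hypothesis h_gt0 : 0 < h.

Lemma is_derive_quadratic (T c s : R) :
  is_derive s (1 : R) (fun s : R => T * s ^+ 2 + c) (T * (2 * s)).
Proof.
have -> : (fun s : R => T * s ^+ 2 + c) = T \*: ((@id R) ^+ 2) + cst c.
  by apply/funext.
by apply: is_derive_eq; rewrite addr0 /= expr1 /GRing.scale /= mulr1.
Qed.

Lemma is_derive_continuous (f : R -> R) (x df : R) :
  is_derive x (1 : R) f df -> {for x, continuous f}.
Proof. by case=> + _ => /derivable1_diffP/differentiable_continuous. Qed.

Lemma is_derive_radial_primitive (T s : R) : 0 < T ->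
  is_derive s (1 : R) (radial_primitive h T) (s * profile h (T * s ^+ 2 + h ^+ 2)).
Proof.
move=> T0; pose q (s : R) : R := T * s ^+ 2 + h ^+ 2.
have q0 : 0 < q s by rewrite /q ltr_wpDl ?exprn_gt0// mulr_ge0 ?sqr_ge0 ?ltW.
have sq0 : Num.sqrt (q s) != 0 by rewrite gt_eqF// sqrtr_gt0.
have dsq : is_derive s (1 : R) (Num.sqrt \o q) ((2 * Num.sqrt (q s))^-1 * (T * (2 * s))).
  apply: is_derive1_comp; [exact: is_derive1_sqrt|exact: is_derive_quadratic].
have dV := @is_deriveV R (Num.sqrt \o q) s _ 1 sq0 dsq.
have -> : radial_primitive h T =
    T^-1 \*: (cst 1 - h \*: (fun y => ((Num.sqrt \o q) y)^-1)).
  by apply/funext.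
apply: is_derive_eq; rewrite sub0r /GRing.scale /= /profile -/(q s).
have sqq : Num.sqrt (q s) ^+ 2 = q s by rewrite sqr_sqrtr// ltW.
move: (Num.sqrt (q s)) sq0 sqq => r r0 <-.
by field; rewrite r0 gt_eqF.
Qed.

Lemma continuous_radial_density (T : R) : 0 < T ->
  continuous (fun s : R => s * profile h (T * s ^+ 2 + h ^+ 2)).
Proof.
move=> T0 s; apply: cvgM; first exact: cvg_id.
have cq := is_derive_continuous (is_derive_quadratic T (h ^+ 2) s).
have q0 : 0 < T * s ^+ 2 + h ^+ 2.
  by rewrite ltr_wpDl ?exprn_gt0// mulr_ge0 ?sqr_ge0 ?ltW.
apply: cvgM; first exact: cvg_cst.
apply: cvgV; first by rewrite mulf_neq0 ?gt_eqF ?sqrtr_gt0.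
apply: cvgM; first exact: cq.
apply: (@continuous_comp _ _ _ (fun s : R => T * s ^+ 2 + h ^+ 2) Num.sqrt) => //.
exact: sqrt_continuous.
Qed.

Lemma integral_radial (T b : R) : 0 < T -> 0 < b ->
  (\int[mu]_(s in `[0%R, b]) (s * profile h (T * s ^+ 2 + h ^+ 2))%:E
   = (radial_primitive h T b)%:E)%E.
Proof.
move=> T0 b0.
have cF x : {for x, continuous (radial_primitive h T)}.
  exact: is_derive_continuous (is_derive_radial_primitive x T0).
rewrite (continuous_FTC2 b0 (F := radial_primitive h T)).
- rewrite [in X in (_ - X)%E]/radial_primitive expr0n mulr0 add0r sqrtr_sqr.
  by rewrite gtr0_norm// divff ?gt_eqF// subrr mulr0 sube0.
- by apply: continuous_subspaceT; exact: continuous_radial_density.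
- split.
  + by move=> x _; case: (is_derive_radial_primitive x T0).
  + by apply: cvg_at_right_filter; exact: cF.
  + by apply: cvg_at_left_filter; exact: cF.
- move=> x _; rewrite derive1E; apply: derive_val.
  exact: is_derive_radial_primitive.
Qed.

(* The density is even, so both halves of the segment reduce to [integral_radial]. *)
Lemma integral_radial_segment (T a b : R) : 0 < T -> 0 < a -> 0 < b ->
  (\int[mu]_s (`|s| * (\1_(`[- a, b]%classic) s * profile h (T * s ^+ 2 + h ^+ 2)))%:E
   = (radial_primitive h T a + radial_primitive h T b)%:E)%E.
Proof.
move=> T0 a0 b0.
pose u (c s : R) : \bar R :=
  (s * profile h (T * s ^+ 2 + h ^+ 2) * \1_(`[0, c]%classic) s)%:E.
have mu_ c : measurable_fun [set: RR] (u c : RR -> \bar R).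
  apply/measurable_EFinP; apply: (@measurable_funM _ _ R).
    by apply: continuous_measurable_fun; exact: continuous_radial_density.
  by apply: measurable_indic.
have u0 c s : (0 <= u c s)%E.
  rewrite /u lee_fin indicE; have [/set_mem /=|_] := boolP (s \in _); last by rewrite mulr0.
  rewrite in_itv /= mulr1 => /andP[s0 _]; rewrite mulr_ge0// ltW//.
  by rewrite profile_gt0// ltr_wpDl ?exprn_gt0// mulr_ge0 ?sqr_ge0 ?ltW.
have uE c : 0 < c -> (\int[mu]_s u c s = (radial_primitive h T c)%:E)%E.
  move=> c0; rewrite -(integral_radial T0 c0) [RHS]integral_mkcond.
  apply: eq_integral => s _; rewrite patchE /u indicE.
  by case: ifP => _; rewrite ?mulr1 ?mulr0.
have uNE c : 0 < c -> (\int[mu]_s u c (- s)%R = (radial_primitive h T c)%:E)%E.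
  move=> c0; rewrite -(uE c c0) -(@integral_affine _ (-1) 0 (u c))//.
  by rewrite normrN1 mul1e; apply: eq_integral => s _; rewrite mulN1r addr0.
rewrite EFinD -(uNE a a0) -(uE b b0) -ge0_integralD//; last first.
  by apply: (measurableT_comp (mu_ a)); exact: oppr_measurable.
apply: eq_integral => s _; rewrite /u -EFinD; congr (_%:E).
rewrite sqrrN !indicE.
have -> : (s \in `[- a, b]%classic) = (- a <= s <= b) by rewrite mem_setE in_itv.
have -> : (s \in `[0, b]%classic) = (0 <= s <= b) by rewrite mem_setE in_itv.
have -> : (- s \in `[0, a]%classic) = (0 <= - s <= a) by rewrite mem_setE in_itv.
rewrite oppr_ge0 lerNl; have [s0|s0|->] := ltgtP s 0.
- have -> : s <= b by rewrite ltW// (lt_trans s0).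
  by rewrite ltr0_norm// /= andbT mulr0 addr0 mulrA mulrAC.
- have -> : - s <= a by rewrite ltW// (lt_trans _ a0)// oppr_lt0.
  by rewrite gtr0_norm// /= mulr0 add0r mulrA mulrAC.
- by rewrite oppr0 normr0 !mul0r addr0.
Qed.
End RadialIntegral.

(** * Line sections of a convex set *)

Section Sections.
Context {R : realType}.

Lemma closed_interval_itv (S : set R) (K : R) : closed S -> is_interval S ->
  S 0 -> (forall s, S s -> `|s| <= K) ->
  exists a b, [/\ 0 <= a, 0 <= b & forall s, S s <-> - a <= s <= b].
Proof.
move=> cS iS S0 bS.
have SK : S `<=` `[- K, K]%classic.
  by move=> s /bS; rewrite ler_norml /= in_itv.
have coS : compact S by apply: subclosed_compact SK => //; exact: segment_compact.
have S0' : S !=set0 by exists 0.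
have cid : {within S, continuous (@id R)} by apply: continuous_subspaceT => s; exact: cvg_id.
have [b /set_mem Sb bmax] := compact_EVT_max S0' coS cid.
have [a /set_mem Sa amin] := compact_EVT_min S0' coS cid.
exists (- a), b; split.
- by rewrite oppr_ge0; apply: amin; exact: mem_set.
- by apply: bmax; exact: mem_set.
move=> s; rewrite opprK; split=> [Ss|asb]; last exact: iS asb.
by rewrite amin ?bmax//; exact: mem_set.
Qed.

Definition line_pt (x d : R * R) (s : R) : R * R := (x.1 + s * d.1, x.2 + s * d.2).

Lemma continuous_line_pt (x d : R * R) : continuous (line_pt x d).
Proof.
move=> s; apply: (@cvg_pair _ _ _ _ (nbhs (_ : R)) (nbhs (_ : R))) => /=.
- by apply: cvgD; [exact: cvg_cst|apply: cvgMr_tmp; exact: cvg_id].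
- by apply: cvgD; [exact: cvg_cst|apply: cvgMr_tmp; exact: cvg_id].
Qed.

Variable A : set (R * R).
Hypothesis clA : closed A.
Hypothesis cvA : convex2 A.
Variable M : R.
Hypothesis bdA : forall y, A y -> `|y.1| <= M /\ `|y.2| <= M.

(** The direction is arbitrary because the lemma serves rays of given slope, the line through two
    points in [exists_translate_notin], and the segment to an outside point in
    [disc_in_of_boundary]. *)
Lemma line_section_itv x d : A x -> d.1 != 0 \/ d.2 != 0 ->
  exists a b, [/\ 0 <= a, 0 <= b & forall s, A (line_pt x d s) <-> - a <= s <= b].
Proof.
move=> Ax d0.
have bnd (u e z : R) : e != 0 -> `|u + z * e| <= M -> `|u| <= M -> `|z| <= (M + M) / `|e|.
  move=> e0 uz uM; rewrite ler_pdivlMr ?normr_gt0// -normrM.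
  rewrite (_ : z * e = (u + z * e) - u); last by rewrite addrC addKr.
  by rewrite (le_trans (ler_normB _ _))// lerD.
have [K bK] : exists K, forall s, A (line_pt x d s) -> `|s| <= K.
  have [x1 x2] := bdA Ax.
  case: d0 => d0.
    by exists ((M + M) / `|d.1|) => s /bdA[s1 _]; exact: bnd d0 s1 x1.
  by exists ((M + M) / `|d.2|) => s /bdA[_ s2]; exact: bnd d0 s2 x2.
apply: (@closed_interval_itv (line_pt x d @^-1` A)) bK.
- by apply: closed_comp => // s _; exact: continuous_line_pt.
- move=> s1 s2 /= A1 A2 s /andP[s1s ss2].
  have [s12|s12] := eqVneq s1 s2.
    suff -> : s = s1 by exact: A1.
    by apply/eqP; rewrite eq_le s1s s12 ss2.
  have s21 : 0 < s2 - s1 by rewrite subr_gt0 lt_neqAle s12 (le_trans s1s).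
  pose t := (s - s1) / (s2 - s1).
  have -> : line_pt x d s = ((1 - t) * (line_pt x d s1).1 + t * (line_pt x d s2).1,
                             (1 - t) * (line_pt x d s1).2 + t * (line_pt x d s2).2).
    by rewrite /line_pt /t /=; congr (_, _); field; rewrite gt_eqF.
  apply: cvA => //; rewrite /t divr_ge0 ?(ltW s21) ?subr_ge0//=.
  by rewrite ler_pdivrMr// mul1r lerD2r.
- by rewrite /line_pt /= !mul0r !addr0 -surjective_pairing.
Qed.

(** The closed disc of radius [h / sqrt 2] around [x] lies in [A]: the form in which the bound on
    [h] enters the concavity argument. *)
Definition disc_in (h : R) (x : R * R) := forall y, 2 * sq_dist x y <= h ^+ 2 -> A y.

Lemma disc_in_interior h x : 0 < h -> disc_in h x -> A° x.
Proof.
(* The square of half-side [h / 2] is inscribed in the disc of radius [h / sqrt 2]. *)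
move=> h0 dx; apply/nbhs_ballP; exists (h / 2) => /=; first by rewrite divr_gt0.
move=> y [] /=; rewrite -!ball_normE /ball_ /= => y1 y2; apply: dx.
have h20 : 0 <= h / 2 by rewrite divr_ge0// ltW.
have sq (z : R) : `|z| < h / 2 -> z ^+ 2 <= (h / 2) ^+ 2.
  by move=> zh; rewrite -real_normK ?num_real// lerXn2r// ?nnegrE// ltW.
have := lerD (sq _ y1) (sq _ y2); rewrite /sq_dist => le.
rewrite (_ : h ^+ 2 = 2 * ((h / 2) ^+ 2 + (h / 2) ^+ 2)); last by field.
by rewrite ler_pM2l.
Qed.

(** Any [z] is the midpoint of its translates by [x - m] and [y - m]; when [z] is in the disc around
    [m], these lie in the discs around [x] and [y]. *)
Lemma disc_in_midpoint h x y : disc_in h x -> disc_in h y ->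
  disc_in h ((x.1 + y.1) / 2, (x.2 + y.2) / 2).
Proof.
move=> dx dy z; set m := (_, _) => mz.
have -> : z = ((1 - 2^-1) * (z.1 - m.1 + x.1) + 2^-1 * (z.1 - m.1 + y.1),
               (1 - 2^-1) * (z.2 - m.2 + x.2) + 2^-1 * (z.2 - m.2 + y.2)).
  by rewrite [LHS]surjective_pairing /m /=; congr (_, _); field.
apply: (@cvA (z.1 - m.1 + x.1, z.2 - m.2 + x.2) (z.1 - m.1 + y.1, z.2 - m.2 + y.2)).
- apply: dx; apply: le_trans mz; rewrite le_eqVlt; apply/orP; left; apply/eqP.
  by rewrite /sq_dist /=; ring.
- apply: dy; apply: le_trans mz; rewrite le_eqVlt; apply/orP; left; apply/eqP.
  by rewrite /sq_dist /=; ring.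
- by rewrite invr_ge0 ler0n invf_le1// ler1n.
Qed.

Lemma ray_ptE (x : R * R) (t s : R) : ray_pt x t s = line_pt x (1, t) s.
Proof. by rewrite /ray_pt /line_pt /= mulr1. Qed.

Lemma sq_dist_ray_pt (x : R * R) (t s : R) : sq_dist x (ray_pt x t s) = (1 + t ^+ 2) * s ^+ 2.
Proof. by rewrite /sq_dist /ray_pt /=; ring. Qed.

Lemma ray_section_itv h x t : 0 < h -> disc_in h x ->
  exists a b, [/\ 0 < a, 0 < b, h ^+ 2 <= 2 * ((1 + t ^+ 2) * a ^+ 2),
    h ^+ 2 <= 2 * ((1 + t ^+ 2) * b ^+ 2) &
    forall s, A (ray_pt x t s) <-> - a <= s <= b].
Proof.
move=> h0 dx.
have Ax : A x by apply: interior_subset; exact: disc_in_interior dx.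
have [a [b [_ _ AE]]] : exists a b, [/\ 0 <= a, 0 <= b &
    forall s, A (line_pt x (1, t) s) <-> - a <= s <= b].
  by apply: line_section_itv => //; left; rewrite oner_neq0.
have T0 : 0 < 1 + t ^+ 2 by rewrite ltr_pwDl// sqr_ge0.
have T2 : 0 < 2 * (1 + t ^+ 2) by rewrite mulr_gt0.
(* The parameter at which the line of slope [t] leaves the disc of radius [h / sqrt 2]. *)
pose r := h / Num.sqrt (2 * (1 + t ^+ 2)).
have r0 : 0 < r by rewrite divr_gt0// sqrtr_gt0.
have rE : 2 * ((1 + t ^+ 2) * r ^+ 2) = h ^+ 2.
  rewrite mulrA /r expr_div_n sqr_sqrtr ?(ltW T2)// mulrCA divff ?mulr1//.
  by rewrite gt_eqF.
have in_r s : s ^+ 2 = r ^+ 2 -> A (ray_pt x t s).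
  by move=> sr; apply: dx; rewrite sq_dist_ray_pt sr rE.
have [_ rb] : - a <= r /\ r <= b by apply/andP/AE; rewrite -ray_ptE; exact: in_r.
have [ra _] : - a <= - r /\ - r <= b.
  by apply/andP/AE; rewrite -ray_ptE; apply: in_r; rewrite sqrrN.
rewrite lerN2 in ra.
have le z : r <= z -> h ^+ 2 <= 2 * ((1 + t ^+ 2) * z ^+ 2).
  move=> rz; rewrite -rE !ler_pM2l// lerXn2r// nnegrE ltW//.
  exact: lt_le_trans rz.
exists a, b; split; [exact: lt_le_trans ra|exact: lt_le_trans rb|exact: le|exact: le|].
by move=> s; rewrite ray_ptE.
Qed.

(* Translating [A] by [x1 - x0] moves part of it outside [A]: look at the last
   point of [A] on the ray from [x0] through [x1]. *)
Lemma exists_translate_notin h x0 x1 : 0 < h -> disc_in h x0 -> disc_in h x1 ->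
  x0 != x1 -> exists z : R * R, [/\ z.1 != 0, A° (x0 + z) & ~ A (x1 + z)].
Proof.
move=> h0 d0 d1 x01.
have Ax0 := disc_in_interior h0 d0.
have Ax1 := interior_subset (disc_in_interior h0 d1).
pose u : R * R := x1 - x0.
have u0 : u.1 != 0 \/ u.2 != 0.
  have [u1|] := eqVneq u.1 0; last by left.
  have [u2|] := eqVneq u.2 0; last by right.
  case/eqP: x01; apply/esym/eqP; rewrite -subr_eq0; apply/eqP.
  by rewrite -/u [LHS]surjective_pairing u1 u2.
have [a [b [_ _ AE]]] := line_section_itv (interior_subset Ax0) u0.
have b1 : 1 <= b.
  have /AE/andP[]// : A (line_pt x0 u 1).
  by rewrite /line_pt !mul1r /u /= !(addrC _ (_ - _)) !subrK -surjective_pairing.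
have b0 : 0 < b by exact: lt_le_trans b1.
have aM : - a <= b.
  by have /AE/andP[? ?] : A (line_pt x0 u 0); [rewrite /line_pt !mul0r !addr0 -surjective_pairing;
    exact: interior_subset|lra].
have Ab : A (line_pt x0 u b) by apply/AE; rewrite lexx aM.
(* Half a step before the exit parameter [b] as seen from [x0]; as [x1 = x0 + u], it is half a step
   past the exit as seen from [x1]. *)
pose w : R * R := ((b - 2^-1) * u.1, (b - 2^-1) * u.2).
have Aw : A° (x0 + w).
  pose t := (b - 2^-1) / b.
  have -> : x0 + w = ((1 - t) * x0.1 + t * (line_pt x0 u b).1,
                      (1 - t) * x0.2 + t * (line_pt x0 u b).2).
    by rewrite [LHS]surjective_pairing /= /t /line_pt /=; congr (_, _); field; rewrite gt_eqF.
  apply: convex2_interior => //; rewrite /t divr_ge0 ?(ltW b0)//=; last by lra.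
  by rewrite ltr_pdivrMr// mul1r; lra.
have nAw : ~ A (x1 + w).
  rewrite (_ : x1 + w = line_pt x0 u (b + 2^-1)); last first.
    rewrite [LHS]surjective_pairing /= /line_pt /= /w /u /=.
    by congr (_, _); field.
  by move=> /AE/andP[_]; lra.
move: w Aw nAw => w Aw nAw.
(* Both conditions are open, so a vertical [w], which has no slope, can be tilted slightly. *)
have oW : open ([set z | A° (x0 + z)] `&` [set z | ~ A (x1 + z)]).
  have ct (x : R * R) : continuous (fun z : R * R => x + z).
    by move=> z; apply: cvgD; [exact: cvg_cst|exact: cvg_id].
  apply: openI; first by apply: open_comp (open_interior A) => z _; exact: ct.
  by apply: open_comp (closed_openC clA) => z _; exact: ct.
have [w1|w1] := eqVneq w.1 0; last by exists w.
have /nbhs_ballP[e /= e0 sub] : nbhs w ([set z | A° (x0 + z)] `&` [set z | ~ A (x1 + z)]).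
  by apply: open_nbhs_nbhs.
exists (e / 2, w.2); split => /=; first by rewrite gt_eqF// divr_gt0.
- apply: (sub (e / 2, w.2) _).1; split; rewrite /= -ball_normE /ball_ /= ?subrr ?normr0//.
  by rewrite w1 sub0r normrN gtr0_norm ?divr_gt0// ltr_pdivrMr// ltr_pMr// ltr1n.
- apply: (sub (e / 2, w.2) _).2; split; rewrite /= -ball_normE /ball_ /= ?subrr ?normr0//.
  by rewrite w1 sub0r normrN gtr0_norm ?divr_gt0// ltr_pdivrMr// ltr_pMr// ltr1n.
Qed.
End Sections.

(** * Strict midpoint concavity of the solid angle *)

Section MidpointConcavity.
Context {R : realType}.
Local Notation mu := (@lebesgue_measure R).
Local Notation RR := (measurableTypeR R).
Local Notation mu2 := (mu \x mu)%E.
Variable h : R.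
Hypothesis h_gt0 : 0 < h.
Variable A : set (R * R).
Hypothesis clA : closed A.
Hypothesis cvA : convex2 A.
Variable M : R.
Hypothesis bdA : forall y, A y -> `|y.1| <= M /\ `|y.2| <= M.

Definition angle_along (x : R * R) (t : R) : \bar R :=
  \int[mu]_s (`|s| * integrand h A x (ray_pt x t s))%:E.

Lemma angle_alongE (x : R * R) (t a b : R) : 0 < a -> 0 < b ->
  (forall s, A (ray_pt x t s) <-> - a <= s <= b) ->
  angle_along x t =
  (radial_primitive h (1 + t ^+ 2) a + radial_primitive h (1 + t ^+ 2) b)%:E.
Proof.
move=> a0 b0 AE; have T0 : 0 < 1 + t ^+ 2 by rewrite ltr_pwDl// sqr_ge0.
rewrite -(integral_radial_segment h_gt0 T0 a0 b0); apply: eq_integral => s _.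
congr (_ * (_ * _))%:E; last by rewrite /kern sq_dist_ray_pt.
rewrite !indicE; congr (_%:R); congr (nat_of_bool _); apply/idP/idP.
- by move=> /set_mem/AE asb; apply/mem_set; rewrite /= in_itv.
- by move=> /set_mem; rewrite /= in_itv => /AE/mem_set.
Qed.

Lemma measurable_angle_along x : measurable_fun [set: RR] (angle_along x : RR -> \bar R).
Proof.
have mi : measurable_fun [set: RR * RR] (fun y : RR * RR => (integrand h A x y)%:E).
  by apply/measurable_EFinP; exact: measurable_integrand.
have := @measurable_fun_fubini_tonelli_G _ _ RR RR R mu _ (measurable_polar x mi).
move=> /(_ (fun y => _)) H.
apply: H => y; rewrite mule_ge0// lee_fin integrand_ge0//.
Qed.

Lemma angle_polar x : (angle h A x = \int[mu]_t angle_along x t)%E.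
Proof.
rewrite /angle (integral_polar x)//.
- by apply/measurable_EFinP; exact: measurable_integrand.
- by move=> y; rewrite lee_fin integrand_ge0.
Qed.

(** By convexity, the section through [xm] contains the average of the sections through [x0] and
    [x1], and the radial inequality applies at each end. A parameter [s] in only one of the two
    sections forces one pair of ends to differ, which gives strictness. *)
Lemma angle_along_midpoint x0 x1 t (xm := ((x0.1 + x1.1) / 2, (x0.2 + x1.2) / 2)) :
  disc_in A h x0 -> disc_in A h x1 ->
  exists p0 p1 pm : R, [/\ angle_along x0 t = p0%:E, angle_along x1 t = p1%:E,
    angle_along xm t = pm%:E, p0 + p1 <= pm + pm &
    (exists s, A (ray_pt x0 t s) /\ ~ A (ray_pt x1 t s)) -> p0 + p1 < pm + pm].
Proof.
move=> d0 d1; have dm : disc_in A h xm by exact: disc_in_midpoint.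
have [a0 [b0 [a00 b00 ha0 hb0 E0]]] := ray_section_itv clA cvA bdA t h_gt0 d0.
have [a1 [b1 [a10 b10 ha1 hb1 E1]]] := ray_section_itv clA cvA bdA t h_gt0 d1.
have [am [bm [am0 bm0 _ _ Em]]] := ray_section_itv clA cvA bdA t h_gt0 dm.
have mid s0 s1 : A (ray_pt x0 t s0) -> A (ray_pt x1 t s1) -> - am <= (s0 + s1) / 2 <= bm.
  move=> A0 A1; apply/Em.
  have -> : ray_pt xm t ((s0 + s1) / 2) =
      ((1 - 2^-1) * (ray_pt x0 t s0).1 + 2^-1 * (ray_pt x1 t s1).1,
       (1 - 2^-1) * (ray_pt x0 t s0).2 + 2^-1 * (ray_pt x1 t s1).2).
    by rewrite /ray_pt /xm /=; congr (_, _); field.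
  by apply: cvA => //; rewrite invr_ge0 ler0n invf_le1// ler1n.
have bm_ge : (b0 + b1) / 2 <= bm.
  have A0 : A (ray_pt x0 t b0) by apply/E0; lra.
  have A1 : A (ray_pt x1 t b1) by apply/E1; lra.
  by case/andP: (mid _ _ A0 A1).
have am_ge : (a0 + a1) / 2 <= am.
  have A0 : A (ray_pt x0 t (- a0)) by apply/E0; lra.
  have A1 : A (ray_pt x1 t (- a1)) by apply/E1; lra.
  by case/andP: (mid _ _ A0 A1) => + _; lra.
set T := 1 + t ^+ 2 in ha0 hb0 ha1 hb1.
have T0 : 0 < T by rewrite ltr_pwDl// sqr_ge0.
pose G := radial_primitive h T.
have G_lt := radial_primitive_midpoint_lt h_gt0 T0.
have G_le c0 c1 cm : 0 < c0 -> 0 < c1 -> h ^+ 2 <= 2 * (T * c0 ^+ 2) ->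
    h ^+ 2 <= 2 * (T * c1 ^+ 2) -> (c0 + c1) / 2 <= cm -> G c0 + G c1 <= 2 * G cm.
  move=> c00 c10 hc0 hc1 cm_ge; have [c01|c01] := eqVneq c0 c1; last by rewrite ltW// G_lt.
  have : G c0 <= G cm by apply: radial_primitive_le => //; lra.
  by rewrite -c01; lra.
exists (G a0 + G b0), (G a1 + G b1), (G am + G bm); split.
- exact: angle_alongE.
- exact: angle_alongE.
- exact: angle_alongE.
- have := G_le _ _ _ a00 a10 ha0 ha1 am_ge.
  by have := G_le _ _ _ b00 b10 hb0 hb1 bm_ge; lra.
case=> s [/E0 s0 /E1 s1].
have [a01|a01] := eqVneq a0 a1; last first.
  have := G_lt _ _ _ a00 a10 a01 ha0 ha1 am_ge; rewrite -/G.
  by have := G_le _ _ _ b00 b10 hb0 hb1 bm_ge; lra.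
have [b01|b01] := eqVneq b0 b1; first by case: s1; rewrite -a01 -b01.
have := G_lt _ _ _ b00 b10 b01 hb0 hb1 bm_ge; rewrite -/G.
by have := G_le _ _ _ a00 a10 ha0 ha1 am_ge; lra.
Qed.

Lemma angle_midpoint_lt x0 x1 : disc_in A h x0 -> disc_in A h x1 -> x0 != x1 ->
  (angle h A x0 + angle h A x1 <
   angle h A ((x0.1 + x1.1) / 2, (x0.2 + x1.2) / 2)%R +
   angle h A ((x0.1 + x1.1) / 2, (x0.2 + x1.2) / 2)%R)%E.
Proof.
move=> d0 d1 x01; set xm := (_, _).
have along0 x t : (0 <= angle_along x t)%E.
  by apply: integral_ge0 => s _; rewrite lee_fin mulr_ge0// integrand_ge0.
have dm : disc_in A h xm by exact: disc_in_midpoint.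
have along_fin x t : disc_in A h x -> angle_along x t \is a fin_num.
  move=> dx; have [a [b [a0 b0 _ _ E]]] := ray_section_itv clA cvA bdA t h_gt0 dx.
  by rewrite (angle_alongE a0 b0 E).
pose f x y t : R := fine (angle_along x t) + fine (angle_along y t).
have mfine x : measurable_fun [set: RR] (fun t : RR => fine (angle_along x t) : RR).
  by apply: (measurableT_comp (fine_measurable _)) => //; exact: measurable_angle_along.
have mf x y : measurable_fun [set: RR] (f x y : RR -> RR).
  by apply: (@measurable_funD _ _ R); exact: mfine.
have fine0 x t : 0 <= fine (angle_along x t) by rewrite fine_ge0.
have intf x y : disc_in A h x -> disc_in A h y ->
    (\int[mu]_t (f x y t)%:E = angle h A x + angle h A y)%E.
  move=> dx dy; rewrite !angle_polar -ge0_integralD//; try exact: measurable_angle_along.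
  by apply: eq_integral => t _; rewrite /f EFinD !fineK// along_fin.
have [z [z1 Az nAz]] := exists_translate_notin clA cvA bdA h_gt0 d0 d1 x01.
(* With the parameter [s = z.1] fixed, the point of slope [t] moves along a vertical line as [t]
   varies. This makes the slopes that separate the two sections at [z.1] contain an open set around
   [z.2 / z.1]. *)
pose U : set R := [set t | A° (line_pt (x0.1 + z.1, x0.2)%R (0, z.1)%R t)] `&`
                  [set t | ~ A (line_pt (x1.1 + z.1, x1.2)%R (0, z.1)%R t)].
have oU : open U.
  apply: openI.
    by apply: open_comp (open_interior A) => t _; exact: continuous_line_pt.
  by apply: open_comp (closed_openC clA) => t _; exact: continuous_line_pt.
have lineE (x : R * R) t : line_pt (x.1 + z.1, x.2) (0, z.1) t = ray_pt x t z.1.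
  by rewrite /line_pt /ray_pt /=; congr (_, _); ring.
have Uz : U (z.2 / z.1).
  by split; rewrite /= lineE /ray_pt mulrCA divff// mulr1.
rewrite -!intf//; apply: (@ge0_integral_lt _ _ _ _ _ _ (U : set RR)) => //.
- exact: mf.
- exact: mf.
- by move=> t; rewrite /f addr_ge0.
- move=> t; have [p0 [p1 [pm [e0 e1 em le _]]]] := angle_along_midpoint t d0 d1.
  by rewrite /f e0 e1 em.
- exact: open_measurable.
- have /nbhs_ballP[e /= e0 sub] : nbhs (z.2 / z.1) U by exact: open_nbhs_nbhs.
  apply: (@lt_le_trans _ _ (mu (ball (z.2 / z.1) e))).
    rewrite (_ : mu _ = (e *+ 2)%:E); first by rewrite lte_fin pmulrn_lgt0.
    by apply: lebesgue_measure_ball; exact: ltW.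
  by apply: le_measure; rewrite ?inE//; [exact: measurable_ball|exact: open_measurable].
- move=> t [/= At nAt]; have [p0 [p1 [pm [e0 e1 em _ lt]]]] := angle_along_midpoint t d0 d1.
  rewrite /f e0 e1 em; apply: lt; exists z.1; rewrite -!lineE; split=> //.
  exact: interior_subset.
- by rewrite intf// lte_add_pinfty// (angle_lty h_gt0 clA bdA).
Qed.
End MidpointConcavity.

(** * Grid sums as integrals of step functions *)

Section GridSums.
Context {R : realType}.
Local Notation mu := (@lebesgue_measure R).
Local Notation RR := (measurableTypeR R).
Local Notation mu2 := (mu \x mu)%E.

(** The coordinates used by [grid_sum]: from [-m] at [k = 0] to [m] at [k = 2 m ^ 2], in steps of
    [1 / m]. *)
Definition node (m k : nat) : R := (k%:R - (m * m)%:R) / m%:R.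
Definition cell (m k : nat) : set R := `[node m k, node m k + m%:R^-1[%classic.

Lemma node_scaled (m k : nat) : (0 < m)%N -> node m k * m%:R = k%:R - (m * m)%:R.
Proof. by move=> m0; rewrite /node divfK// pnatr_eq0 -lt0n. Qed.

Lemma cell_scaled (m k : nat) (y : R) : (0 < m)%N -> cell m k y ->
  k%:R <= y * m%:R + (m * m)%:R < k.+1%:R.
Proof.
move=> m0; have m0' : 0 < m%:R :> R by rewrite ltr0n.
rewrite /cell /= in_itv /= -(ler_pM2r m0') -(ltr_pM2r m0' y) mulrDl.
rewrite (node_scaled _ m0) mulVf ?gt_eqF// => /andP[k1 k2].
by rewrite -natr1; apply/andP; split; lra.
Qed.

Lemma cell_inj (m k k' : nat) (y : R) : (0 < m)%N -> cell m k y -> cell m k' y -> k = k'.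
Proof.
move=> m0 /(cell_scaled m0)/andP[k1 k2] /(cell_scaled m0)/andP[k1' k2'].
have := le_lt_trans k1 k2'; have := le_lt_trans k1' k2.
rewrite !ltr_nat !ltnS => kk' k'k; apply/eqP.
by rewrite eqn_leq kk' k'k.
Qed.

Lemma exists_cell (m : nat) (y : R) : (0 < m)%N -> `|y| <= m%:R ->
  exists k : 'I_(2 * m * m).+1, cell m k y.
Proof.
move=> m0 ym; have m0' : 0 < m%:R :> R by rewrite ltr0n.
move: ym; rewrite ler_norml => /andP[y1 y2].
have s0 : 0 <= y * m%:R + (m * m)%:R.
  by rewrite natrM -mulrDl mulr_ge0 ?(ltW m0')//; lra.
have /andP[k1 k2] := truncn_itv s0.
have kN : (Num.truncn (y * m%:R + (m * m)%:R) < (2 * m * m).+1)%N.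
  rewrite ltnS -(ler_nat R); apply: le_trans k1 _.
  by rewrite -mulnA mul2n -addnn natrD lerD2r natrM ler_pM2r.
exists (Ordinal kN); rewrite /cell /= in_itv /= -(ler_pM2r m0') -(ltr_pM2r m0' y) mulrDl.
rewrite (node_scaled _ m0) mulVf ?gt_eqF//.
by move: k1 k2; rewrite -natr1 => k1 k2; apply/andP; split; lra.
Qed.

Lemma cell_dist (m k : nat) (y : R) : cell m k y -> `|y - node m k| <= m%:R^-1.
Proof.
rewrite /cell /= in_itv /= => /andP[k1 k2].
by rewrite ger0_norm ?subr_ge0// lerBlDl ltW.
Qed.

(** Its integral is the grid sum, so convergence of Riemann sums becomes a limit of integrals. The
    cells are half-open and therefore disjoint. *)
Definition grid_step (F : R * R -> R) (n : nat) (y : RR * RR) : R :=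
  let m := n.+1 in
  \sum_(i < (2 * m * m).+1) \sum_(j < (2 * m * m).+1)
    F (node m i, node m j) * \1_(cell m i `*` cell m j) y.

Definition grid_total (F : R * R -> R) (n : nat) : R :=
  let m := n.+1 in
  \sum_(i < (2 * m * m).+1) \sum_(j < (2 * m * m).+1)
    F (node m i, node m j) / (m%:R * m%:R).

Lemma grid_step_cell F n y (i j : 'I_(2 * n.+1 * n.+1).+1) :
  cell n.+1 i y.1 -> cell n.+1 j y.2 ->
  grid_step F n y = F (node n.+1 i, node n.+1 j).
Proof.
move=> yi yj; rewrite /grid_step /= (bigD1 i)//= [X in _ + X]big1 ?addr0.
  rewrite (bigD1 j)//= [X in _ + X]big1 ?addr0.
    by rewrite indicE mem_set ?mulr1//; split.
  move=> j' /eqP jj'; rewrite indicE memNset ?mulr0// => -[_ yj'].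
  by apply: jj'; apply: val_inj; exact: cell_inj yj' yj.
move=> i' /eqP ii'; apply: big1 => j' _; rewrite indicE memNset ?mulr0// => -[yi' _].
by apply: ii'; apply: val_inj; exact: cell_inj yi' yi.
Qed.

Lemma grid_stepP F n y : grid_step F n y = 0 \/
  exists i j : 'I_(2 * n.+1 * n.+1).+1, [/\ cell n.+1 i y.1, cell n.+1 j y.2 &
    grid_step F n y = F (node n.+1 i, node n.+1 j)].
Proof.
have [[i [j [yi yj]]]|nex] := pselect (exists i j : 'I_(2 * n.+1 * n.+1).+1,
    cell n.+1 i y.1 /\ cell n.+1 j y.2).
  by right; exists i, j; split => //; exact: grid_step_cell.
left; rewrite /grid_step big1// => i _; rewrite big1// => j _.
by rewrite indicE memNset ?mulr0// => -[yi yj]; apply: nex; exists i, j.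
Qed.

Lemma measurable_cell m k : measurable (cell m k : set RR).
Proof. exact: measurable_itv. Qed.

Lemma measurable_grid_step F n :
  measurable_fun [set: RR * RR] (grid_step F n : RR * RR -> RR).
Proof.
apply: measurable_sum => i; apply: measurable_sum => j.
apply: (@measurable_funM _ _ R) => //; apply: measurable_indic.
by apply: measurableX; exact: measurable_cell.
Qed.

Lemma integral_grid_step F n : (forall y, 0 <= F y) ->
  (\int[mu2]_y (grid_step F n y)%:E = (grid_total F n)%:E)%E.
Proof.
move=> F0; rewrite /grid_step /grid_total; set m := n.+1.
have mX i j : measurable (cell m i `*` cell m j : set (RR * RR)).
  by apply: measurableX; exact: measurable_cell.
have m1 i j : measurable_fun [set: RR * RR]
    (fun y : RR * RR => (F (node m i, node m j) * \1_(cell m i `*` cell m j) y)%:E : \bar R).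
  apply/measurable_EFinP; apply: (@measurable_funM _ _ R); first exact: measurable_cst.
  by apply: measurable_indic; exact: mX.
have p1 i j (y : RR * RR) : (0 <= (F (node m i, node m j) * \1_(cell m i `*` cell m j) y)%:E)%E.
  by rewrite lee_fin mulr_ge0.
under eq_integral do (rewrite -sumEFin; under eq_bigr do rewrite -sumEFin).
rewrite ge0_integral_sum//; last 2 first.
- by move=> i; apply: emeasurable_sum => j; exact: m1.
- by move=> i y _; apply: sume_ge0 => j _; exact: p1.
rewrite -sumEFin; apply: eq_bigr => i _; rewrite ge0_integral_sum//.
rewrite -sumEFin; apply: eq_bigr => j _.
under eq_integral do rewrite EFinM.
rewrite ge0_integralZl//; last 2 first.
- by apply/measurable_EFinP; exact: measurable_indic.
- by rewrite lee_fin.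
rewrite integral_indic// setIT EFinM; congr (_ * _)%E.
have len k : mu (cell m k) = (m%:R^-1)%:E.
  rewrite lebesgue_measure_itv /= lte_fin ltrDl invr_gt0 ltr0n /=.
  by rewrite -EFinB addrC addKr.
transitivity (mu (cell m i) * mu (cell m j))%E.
  by apply: product_measure1E; exact: measurable_cell.
by rewrite invfM EFinM; congr (_ * _)%E; exact: len.
Qed.
End GridSums.

(** * Convergence of the grid sums *)

Section GridConvergence.
Context {R : realType}.
Local Notation mu := (@lebesgue_measure R).
Local Notation RR := (measurableTypeR R).
Local Notation mu2 := (mu \x mu)%E.
Variable h : R.
Hypothesis h_gt0 : 0 < h.
Variable A : set (R * R).
Hypothesis clA : closed A.
Variable M : R.
Hypothesis bdA : forall y, A y -> `|y.1| <= M /\ `|y.2| <= M.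

Lemma kernC (x y : R * R) : kern h x y = kern h y x.
Proof. by rewrite /kern /sq_dist; congr profile; ring. Qed.

Lemma kern_dist_le (x p y : R * R) (e : R) : `|y.1 - p.1| <= e -> `|y.2 - p.2| <= e ->
  `|kern h x y - kern h x p| <= 3 / h ^+ 3 * (e + e).
Proof.
move=> e1 e2; rewrite !(kernC x).
have C0 : 0 <= 3 / h ^+ 3 by rewrite divr_ge0// exprn_ge0// ltW.
have Ce (a b : R) : a <= e -> b <= e -> 3 / h ^+ 3 * (a + b) <= 3 / h ^+ 3 * (e + e).
  by move=> ae be; rewrite ler_wpM2l// lerD.
have l1 := kern_lipschitz h_gt0 y p x; have l2 := kern_lipschitz h_gt0 p y x.
rewrite (distrC p.1) (distrC p.2) in l2.
by rewrite ler_norml; apply/andP; split; have := Ce _ _ e1 e2; lra.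
Qed.

(** Off the boundary, [y] has a neighbourhood inside [A] or inside its complement; a node within
    [1 / (n + 1)] of [y] in each coordinate eventually lies there too, and the Lipschitz bound on
    the kernel concludes. *)
Lemma grid_step_cvg x y : ~ (A `\` A°) y ->
  grid_step (integrand h A x) n y @[n --> \oo] --> integrand h A x y.
Proof.
move=> nBy; apply/cvgrPdist_lt => eps eps0.
have [Ay|nAy] := pselect (A y); last first.
  have Fy : integrand h A x y = 0 by rewrite /integrand indicE memNset// mul0r.
  have /nbhs_ballP[e /= e0 sub] : nbhs y (~` A).
    by apply: open_nbhs_nbhs; split => //; exact: closed_openC.
  near=> n.
  have ne : n.+1%:R^-1 < e by near: n; exact: (near_infty_natSinv_lt (PosNum e0)).
  rewrite Fy sub0r normrN; case: (grid_stepP (integrand h A x) n y) => [->|[i [j [yi yj ->]]]].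
    by rewrite normr0.
  rewrite /integrand indicE memNset ?mul0r ?normr0//; apply: sub.
  by split; rewrite -ball_normE /ball_ /=; apply: le_lt_trans ne; exact: cell_dist.
have Aoy : A° y by apply: contrapT => nAo; apply: nBy.
have /nbhs_ballP[e /= e0 sub] := Aoy.
have C0 : 0 < 3 / h ^+ 3 by rewrite divr_gt0// exprn_gt0.
have d0 : 0 < eps / (3 / h ^+ 3 * 2) by rewrite divr_gt0// mulr_gt0.
near=> n.
have ne : n.+1%:R^-1 < e by near: n; exact: (near_infty_natSinv_lt (PosNum e0)).
have nd : n.+1%:R^-1 < eps / (3 / h ^+ 3 * 2).
  by near: n; exact: (near_infty_natSinv_lt (PosNum d0)).
have n1 : `|y.1| <= n.+1%:R.
  rewrite -natr1; apply: (@le_trans _ _ n%:R); last by rewrite lerDl.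
  by near: n; exact: nbhs_infty_ger.
have n2 : `|y.2| <= n.+1%:R.
  rewrite -natr1; apply: (@le_trans _ _ n%:R); last by rewrite lerDl.
  by near: n; exact: nbhs_infty_ger.
have [i yi] := exists_cell (ltn0Sn n) n1.
have [j yj] := exists_cell (ltn0Sn n) n2.
rewrite (grid_step_cell _ yi yj).
have Ap : A (node n.+1 i, node n.+1 j).
  by apply: sub; split; rewrite -ball_normE /ball_ /=; apply: le_lt_trans ne; exact: cell_dist.
rewrite /integrand !indicE (mem_set Ay) (mem_set Ap) !mul1r.
have /= le := @kern_dist_le x (node n.+1 i, node n.+1 j) y _ (cell_dist yi) (cell_dist yj).
apply: le_lt_trans le _.
have C2 : 0 < 3 / h ^+ 3 * 2 by rewrite pmulr_lgt0.
rewrite (ltr_pdivlMr _ _ C2) in nd.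
have E (K r : R) : K * (r + r) = r * (K * 2) by ring.
by rewrite E.
Unshelve. all: by end_near. Qed.

Lemma grid_total_cvg x x0 : convex2 A -> A° x0 ->
  grid_total (integrand h A x) n @[n --> \oo] --> fine (angle h A x).
Proof.
move=> cvA Ax0.
have i0 y : 0 <= integrand h A x y by exact: integrand_ge0.
pose C := profile h (h ^+ 2).
have C0 : 0 <= C by rewrite ltW// profile_gt0// exprn_gt0.
(* A cell whose node lies in [A] may stick out of [A], but by at most its side, which does not
   exceed 1; hence the margin in [M + 1]. *)
pose B : set (RR * RR) := `[(- (M + 1))%R, (M + 1)%R]%classic `*` `[(- (M + 1))%R, (M + 1)%R]%classic.
have mB : measurable B by exact: measurableX.
have mD : measurable_fun [set: RR * RR] (fun y => (\1_B y * C)%:E : \bar R).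
  apply/measurable_EFinP; apply: (@measurable_funM _ _ R); last exact: measurable_cst.
  exact: measurable_indic.
have D0 y : 0 <= \1_B y * C by rewrite mulr_ge0.
have iD : (mu2).-integrable [set: RR * RR] (fun y => (\1_B y * C)%:E).
  apply/integrableP; split => //.
  under eq_integral do rewrite gee0_abs ?lee_fin// mulrC EFinM.
  rewrite ge0_integralZl//; last by apply/measurable_EFinP; exact: measurable_indic.
  rewrite integral_indic// setIT lte_mul_pinfty//.
  exact: square_area_fin.
have step_le n y : 0 <= grid_step (integrand h A x) n y <= \1_B y * C.
  case: (grid_stepP (integrand h A x) n y) => [->|[i [j [yi yj ->]]]]; first by rewrite lexx D0.
  rewrite i0 /=; set p := (_, _).
  rewrite {1}/integrand indicE; have [/set_mem Ap|_] := boolP (p \in A); last by rewrite mul0r.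
  rewrite indicE mem_set ?mul1r ?kern_le_max//.
  have [p1 p2] := bdA Ap.
  have n1 : n.+1%:R^-1 <= 1 :> R by rewrite invf_le1 ?ler1n.
  have := le_trans (cell_dist yi) n1; have := le_trans (cell_dist yj) n1.
  move: p1 p2; rewrite /= !ler_norml => /andP[? ?] /andP[? ?] /andP[? ?] /andP[? ?].
  by split; rewrite /= in_itv /=; apply/andP; split; lra.
have mi : measurable_fun [set: RR * RR] (fun y : RR * RR => (integrand h A x y)%:E : \bar R).
  by apply/measurable_EFinP; exact: measurable_integrand.
have ms n : measurable_fun [set: RR * RR]
    (fun y : RR * RR => (grid_step (integrand h A x) n y)%:E : \bar R).
  by apply/measurable_EFinP; exact: measurable_grid_step.
have [||_ _ cvg] := dominated_convergence measurableT ms mi _ iD.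
- exists (A `\` A°); split.
  + exact: measurable_convex_boundary.
  + exact: convex_boundary_null Ax0.
  + move=> y /= ny; apply: contrapT => nB; apply: ny => _.
    by apply: cvg_EFin; [exact: nearW|exact: grid_step_cvg].
- exists set0; split => // y /= ny; exfalso; apply: ny => n _.
  by have /andP[s0 sD] := step_le n y; rewrite /= lee_fin ger0_norm.
apply: (fine_cvg (f := fun n => (grid_total (integrand h A x) n)%:E)).
rewrite fineK ?(angle_fin h_gt0 clA bdA)//.
rewrite (_ : (fun n => _) = (fun n => \int[mu2]_y (grid_step (integrand h A x) n y)%:E)%E) //.
by apply/funext => n; rewrite integral_grid_step.
Qed.

Lemma grid_total_dist_lt x x0 (e : R) : convex2 A -> A° x0 -> 0 < e ->
  exists N, forall n, (N <= n)%N ->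
    `|grid_total (integrand h A x) n - fine (angle h A x)| < e.
Proof.
move=> cvA Ax0 e0; have /cvgrPdist_lt/(_ e e0)[N _ NP] := grid_total_cvg (x := x) cvA Ax0.
by exists N => n Nn; rewrite distrC; exact: NP.
Qed.
End GridConvergence.

(** * Euclidean distance against the product topology *)

Section SqDistTopology.
Context {R : realType}.
Implicit Types (A : set (R * R)) (x y : R * R).

Lemma ball_sq_dist x y (e : R) : 0 < e -> ball x (e / 2) y -> sq_dist x y < e ^+ 2.
Proof.
move=> e0 []; rewrite -!ball_normE /ball_ /= => y1 y2.
have sq (r : R) : `|r| < e / 2 -> r ^+ 2 < (e / 2) ^+ 2.
  by move=> re; rewrite -real_normK ?num_real// ltrXn2r// ?nnegrE// ltW// divr_gt0.
apply: lt_le_trans (ltrD (sq _ y1) (sq _ y2)) _.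
rewrite (_ : _ + _ = e ^+ 2 / 2); last by field.
by rewrite ler_pdivrMr// ler_peMr ?ler1n// exprn_ge0// ltW.
Qed.

Lemma sq_dist_closed A :
  (forall x, (forall e, 0 < e -> exists y, A y /\ sq_dist x y < e ^+ 2) -> A x) ->
  closed A.
Proof.
move=> cl x clx; apply: cl => e e0.
have [y [Ay xy]] := clx _ (nbhsx_ballx x _ (divr_gt0 e0 (ltr0n R 2))).
by exists y; split => //; exact: ball_sq_dist.
Qed.

Lemma sq_dist_interior A x (e : R) : 0 < e ->
  (forall y, sq_dist x y < e ^+ 2 -> A y) -> A° x.
Proof.
move=> e0 sub; apply/nbhs_ballP; exists (e / 2) => /=; first exact: divr_gt0.
by move=> y xy; apply: sub; exact: ball_sq_dist.
Qed.
End SqDistTopology.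

(** * Existence, location and uniqueness of maximizers *)

Section Maximizers.
Context {R : realType}.
Variable h : R.
Hypothesis h_gt0 : 0 < h.
Variable A : set (R * R).
Hypothesis clA : closed A.
Hypothesis cvA : convex2 A.
Variable M : R.
Hypothesis bdA : forall y, A y -> `|y.1| <= M /\ `|y.2| <= M.
Variable x0 : R * R.
Hypothesis Ax0 : A° x0.

(** If a point [y] of the disc were outside [A], the segment from [z] to [y] would leave [A] at a
    parameter [b < 1], at a boundary point strictly closer to [z] than [y]. *)
Lemma disc_in_of_boundary z : A z ->
  (forall w, A w -> (forall e, 0 < e -> exists q, ~ A q /\ sq_dist w q < e ^+ 2) ->
    h ^+ 2 <= 2 * sq_dist z w) ->
  disc_in A h z.
Proof.
move=> Az bd y yh; apply: contrapT => nAy.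
pose d : R * R := (y.1 - z.1, y.2 - z.2).
have lineE s : sq_dist z (line_pt z d s) = s ^+ 2 * sq_dist z y.
  by rewrite /sq_dist /line_pt /d /=; ring.
have y1 : line_pt z d 1 = y.
  by rewrite [RHS]surjective_pairing /line_pt /d /=; congr (_, _); ring.
have d0 : d.1 != 0 \/ d.2 != 0.
  have [d1|] := eqVneq d.1 0; last by left.
  have [d2|] := eqVneq d.2 0; last by right.
  case: nAy; rewrite -y1 /line_pt d1 d2 !mulr0 !addr0 -surjective_pairing; exact: Az.
have S0 : 0 < sq_dist z y.
  rewrite /sq_dist (_ : _ + _ = d.1 ^+ 2 + d.2 ^+ 2); last by rewrite /d /=; ring.
  by case: d0 => d0; [rewrite ltr_pwDl|rewrite ltr_wpDl];
    rewrite ?sqr_ge0// exprn_even_gt0.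
have [a [b [a0 b0 AE]]] := line_section_itv clA cvA bdA Az d0.
have b1 : b < 1.
  rewrite ltNge; apply/negP => b1; apply: nAy; rewrite -y1; apply/AE.
  by rewrite b1 andbT; lra.
have Ab : A (line_pt z d b) by apply/AE; rewrite lexx andbT; lra.
have /bd : forall e, 0 < e -> exists q, ~ A q /\ sq_dist (line_pt z d b) q < e ^+ 2.
  move=> e e0; have S1 : 0 < 1 + sq_dist z y by rewrite addr_gt0.
  (* A step past the exit point that stays within [e] of it, because
     [sq_dist z y < (1 + sq_dist z y) ^ 2]. *)
  pose r := e / (1 + sq_dist z y).
  have r0 : 0 < r by rewrite divr_gt0.
  exists (line_pt z d (b + r)); split; first by move=> /AE/andP[_]; lra.
  rewrite (_ : sq_dist _ _ = r ^+ 2 * sq_dist z y); last first.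
    by rewrite /sq_dist /line_pt /d /=; ring.
  rewrite /r expr_div_n mulrAC ltr_pdivrMr ?exprn_gt0// ltr_pM2l ?exprn_gt0//.
  by rewrite (_ : _ ^+ 2 = 1 + sq_dist z y + sq_dist z y * (1 + sq_dist z y));
    [have : 0 < sq_dist z y * (1 + sq_dist z y) by exact: mulr_gt0|ring]; lra.
move=> /(_ Ab); rewrite lineE; apply/negP; rewrite -ltNge; apply: lt_le_trans yh.
by rewrite ltr_pM2l// gtr_pMl// expr2; nra.
Qed.

Local Notation angle_val x := (fine (angle h A x)).

Lemma angle_val_lipschitz : exists C : R, forall x x',
  `|angle_val x - angle_val x'| <= C * (`|x.1 - x'.1| + `|x.2 - x'.2|).
Proof.
have fin x := angle_fin h_gt0 clA bdA x.
set area := (lebesgue_measure \x lebesgue_measure)%E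
  (A : set (measurableTypeR R * measurableTypeR R)).
have afin : area \is a fin_num.
  by rewrite ge0_fin_numE; [exact: (area_fin clA bdA)|exact: measure_ge0].
exists (3 / h ^+ 3 * fine area) => x x'.
have le y y' : angle_val y <= angle_val y' +
    3 / h ^+ 3 * fine area * (`|y.1 - y'.1| + `|y.2 - y'.2|).
  have := angle_lipschitz h_gt0 clA y y'; rewrite -/area.
  rewrite -(fineK (fin y)) -(fineK (fin y')) -(fineK afin) -EFinM -EFinD lee_fin /=.
  by rewrite [X in _ + X]mulrAC.
have := le x x'; have := le x' x; rewrite (distrC x'.1) (distrC x'.2) => l1 l2.
by rewrite ler_norml; apply/andP; split; lra.
Qed.

Lemma continuous_angle_val : continuous (fun x : R * R => angle_val x).
Proof.
have [C lipC] := angle_val_lipschitz.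
move=> x; apply/cvgrPdist_lt => e e0.
have C0 : 0 < `|C| + 1 by rewrite ltr_wpDl.
have d0 : 0 < e / (2 * (`|C| + 1)) by rewrite divr_gt0// mulr_gt0.
near=> y.
have [] : ball x (e / (2 * (`|C| + 1))) y by near: y; exact: (nbhsx_ballx x _ d0).
rewrite /= -!ball_normE /ball_ /= => y1 y2.
apply: le_lt_trans (lipC x y) _.
apply: (@le_lt_trans _ _ ((`|C| + 1) * (`|x.1 - y.1| + `|x.2 - y.2|))).
  by rewrite ler_wpM2r ?addr_ge0// (le_trans (ler_norm _))// lerDl.
have := ltrD y1 y2; rewrite -(ltr_pM2l C0) => lt.
apply: lt_le_trans lt _; rewrite le_eqVlt; apply/orP; left; apply/eqP.
by field; rewrite gt_eqF.
Unshelve. all: by end_near. Qed.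

(* Clamping to a square containing [A] brings a point closer to all of [A]. *)
Lemma exists_angle_max : exists x, forall y, angle_val y <= angle_val x.
Proof.
have fin x := angle_fin h_gt0 clA bdA x.
have M0 : 0 <= M.
  by have [+ _] := bdA (interior_subset Ax0); apply: le_trans.
pose B : set (R * R) := `[- M, M]%classic `*` `[- M, M]%classic.
have cB : compact B by apply: compact_setX; exact: segment_compact.
have B0 : B !=set0.
  by exists (0, 0); split; rewrite /= in_itv /= oppr_le0 M0.
have [x Bx xmax] := compact_EVT_max B0 cB
  (continuous_subspaceT continuous_angle_val).
exists x => y; pose cl (z : R) := Num.max (- M) (Num.min z M).
have clB z : cl z \in `[- M, M].
  by rewrite in_itv /= le_max lexx /= ge_max ge_min lexx orbT andbT; lra.
have cl_dist (z a : R) : `|a| <= M -> (cl z - a) ^+ 2 <= (z - a) ^+ 2.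
  rewrite ler_norml => /andP[a1 a2]; rewrite /cl.
  have [zM|zM] := leP z M; have [Mz|Mz] := leP (- M) _ => //.
  - by nra.
  - by nra.
  - by nra.
apply: (@le_trans _ _ (angle_val (cl y.1, cl y.2))); last first.
  by apply: xmax; apply/mem_set; split; exact: clB.
apply: fine_le; rewrite ?fin//; apply: (angle_le h_gt0 clA) => a Aa.
by have [a1 a2] := bdA Aa; rewrite /sq_dist lerD// cl_dist.
Qed.

(** Replacing [v] by [-v] and [b] by [-b] turns [lower_ok] into this condition as well, so only one
    side has to be treated. *)
Definition folds_above (v : R * R) (b : R) := forall c, b <= c ->
  forall z, A z -> c <= dotp z v -> A (reflection v c z).

(** Supplies the strictness in [angle_lt_reflection]. If the reflection at [c] mapped [A] into
    itself, alternating it with the fold at [b] would carry points of [A] arbitrarily far in the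
    direction [-v], against boundedness. *)
Lemma exists_interior_unfolded v b c : dotp v v = 1 -> folds_above v b -> b < c ->
  exists y, A° y /\ ~ A (reflection v c y).
Proof.
move=> v1 fold bc.
have dr z e : dotp (reflection v e z) v = 2 * e - dotp z v.
  by have := dotp_reflection e z v1; lra.
have [y1 [Ay1 nAy1]] : exists y, A y /\ ~ A (reflection v c y).
  apply: contrapT => nex.
  have Ac y : A y -> A (reflection v c y).
    by move=> Ay; apply: contrapT => nA; apply: nex; exists y.
  (* Folding at c and then at b translates by -2 (c - b) v. *)
  have down k : exists y, A y /\ dotp y v <= b - 2 * k%:R * (c - b).
    elim: k => [|k [y [Ay yk]]].
      have Ax := interior_subset Ax0.
      have [xb|xb] := leP (dotp x0 v) b; first by exists x0; split=> //; rewrite mulr0 mul0r subr0.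
      exists (reflection v b x0); split; first by apply: fold => //; exact: ltW.
      by rewrite dr mulr0 mul0r subr0; lra.
    exists (reflection v b (reflection v c y)); split.
      apply: fold => //; first exact: Ac.
      rewrite dr; have : 0 <= 2 * k%:R * (c - b) by rewrite !mulr_ge0// subr_ge0 ltW.
      by lra.
    by rewrite !dr -natr1; lra.
  have low y : A y -> - (M * `|v.1| + M * `|v.2|) <= dotp y v.
    move=> /bdA[m1 m2]; rewrite lerNl (le_trans (ler_norm _))// normrN.
    by rewrite (le_trans (ler_normD _ _))// lerD// normrM ler_wpM2r.
  pose L := `|b + (M * `|v.1| + M * `|v.2|)| / (c - b).
  have cb : 0 < c - b by rewrite subr_gt0.
  have L0 : 0 <= L by rewrite divr_ge0// ltW.
  have [y [Ay yk]] := down (Num.truncn L).+1.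
  have /andP[_ Lk] := truncn_itv L0.
  have := low _ Ay; have := ler_norm (b + (M * `|v.1| + M * `|v.2|)).
  move: Lk; rewrite /L ltr_pdivrMr// => Lk.
  have : 0 <= (Num.truncn L).+1%:R * (c - b) by rewrite mulr_ge0// ltW.
  by move: yk Lk; rewrite -/L -mulrA; lra.
(* The point [y1] may lie on the boundary. A small move towards the interior point [x0] enters the
   interior, while the reflected point stays in the open complement of [A]. *)
pose V := [set s | ~ A (reflection v c (line_pt y1 (x0 - y1) s))].
have oV : open V.
  apply: (@open_comp _ _ (fun s => reflection v c (line_pt y1 (x0 - y1) s)) (~` A));
    last exact: closed_openC.
  move=> s _; apply: (@continuous_comp _ _ _ (line_pt y1 (x0 - y1)) (reflection v c)).
    exact: continuous_line_pt.
  exact: continuous_reflection.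
have V0 : V 0 by rewrite /V /= /line_pt !mul0r !addr0 -surjective_pairing.
have /nbhs_ballP[e /= e0 sub] : nbhs 0 V by exact: open_nbhs_nbhs.
pose s := Num.min (e / 2) (1 / 2).
have s0 : 0 < s by rewrite lt_min !divr_gt0.
have s1 : s <= 1 / 2 by rewrite ge_min lexx orbT.
have se : s < e by rewrite gt_min; apply/orP; left; lra.
exists (line_pt y1 (x0 - y1) s); split; last first.
  by apply: sub; rewrite -ball_normE /ball_ /= sub0r normrN gtr0_norm.
have -> : line_pt y1 (x0 - y1) s =
    ((1 - (1 - s)) * x0.1 + (1 - s) * y1.1, (1 - (1 - s)) * x0.2 + (1 - s) * y1.2).
  by rewrite /line_pt /=; congr (_, _); ring.
by apply: convex2_interior => //; lra.
Qed.

Lemma angle_max_unfolded v b x : (forall y, angle_val y <= angle_val x) ->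
  dotp v v = 1 -> folds_above v b -> dotp x v <= b.
Proof.
move=> xmax v1 fold; rewrite leNgt; apply/negP => bx.
(* The mirror must be strictly above [b], to leave an unfolded interior point, and strictly below
   [x]. *)
pose c := (b + dotp x v) / 2.
have bc : b < c by rewrite /c; lra.
have cx : c < dotp x v by rewrite /c; lra.
have [y0 [Ay0 nAy0]] := exists_interior_unfolded v1 fold bc.
have := angle_lt_reflection h_gt0 clA bdA v1 cx (fold c (ltW bc)) Ay0 nAy0.
have fin z := angle_fin h_gt0 clA bdA z.
rewrite -(fineK (fin x)) -(fineK (fin (reflection v c x))) lte_fin.
by rewrite ltNge xmax.
Qed.

Lemma angle_max_unique x y : (forall z, angle_val z <= angle_val x) ->
  (forall z, angle_val z <= angle_val y) ->
  disc_in A h x -> disc_in A h y -> x = y.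
Proof.
move=> xmax ymax dx dy; apply/eqP; apply: contrapT => /negP xy.
have := angle_midpoint_lt h_gt0 clA cvA bdA dx dy xy; set m := (_, _).
have fin z := angle_fin h_gt0 clA bdA z.
rewrite -(fineK (fin x)) -(fineK (fin y)) -(fineK (fin m)) -!EFinD lte_fin.
by rewrite ltNge lerD.
Qed.
End Maximizers.

(* Transfer to the Stdlib definitions *)
From Stdlib Require Import Reals Lra.
From mathcomp Require Import Rstruct Rstruct_topology.
Require Import Defs.
Local Open Scope ring_scope.

Section StdlibReals.
Implicit Types (Om : pt -> Prop) (x y z w v : pt).
Local Notation R := Rdefinitions.R.

Lemma IZR2E : IZR 2 = 2 :> R.
Proof. by []. Qed.

Lemma sqdistE x y : sqdist x y = sq_dist x y.
Proof. by rewrite /sqdist !RpowE. Qed.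

Lemma dist2_lt x y (e : R) : 0 < e -> (dist2 x y < e)%coqR <-> sq_dist x y < e ^+ 2.
Proof.
move=> e0; rewrite /dist2 sqdistE RsqrtE; split.
  move=> /RltP; rewrite -(@ltr_pXn2r _ 2)// ?nnegrE ?sqrtr_ge0 ?ltW//.
  by rewrite sqr_sqrtr ?sq_dist_ge0.
move=> lt; apply/RltP; rewrite -(@ltr_pXn2r _ 2)// ?nnegrE ?sqrtr_ge0 ?ltW//.
by rewrite sqr_sqrtr ?sq_dist_ge0.
Qed.

Lemma closed_set2_closed Om : closed_set2 Om -> closed (Om : set (R * R)).
Proof.
move=> cl; apply: sq_dist_closed => x clx; apply: cl => e /RltP e0.
by have [y [Oy xy]] := clx _ e0; exists y; split => //; exact/dist2_lt.
Qed.

Lemma interior2_interior Om x : interior2 Om x -> (Om : set (R * R))° x.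
Proof.
case=> e [/RltP e0 sub]; apply: (sq_dist_interior e0) => y xy.
by apply: sub; apply/(dist2_lt x y e0).
Qed.

Lemma convex_set_convex2 Om : convex_set Om -> convex2 (Om : set (R * R)).
Proof.
move=> cv x y t Ox Oy /andP[/RleP t0 /RleP t1]; exact: cv Ox Oy (conj t0 t1).
Qed.

Lemma bounded_set2_le Om : bounded_set2 Om ->
  exists M : R, forall y : R * R, Om y -> `|y.1| <= M /\ `|y.2| <= M.
Proof.
case=> M bM; exists M => y /bM /RleP; rewrite /dist2 sqdistE RsqrtE => yM.
have y2 : y.1 ^+ 2 + y.2 ^+ 2 = sq_dist y (0, 0) by rewrite /sq_dist /= !subr0.
by split; apply: le_trans yM; rewrite -sqrtr_sqr ler_wsqrtr// -y2;
  [rewrite lerDl|rewrite lerDr]; rewrite sqr_ge0.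
Qed.

Lemma upper_ok_folds Om v b : upper_ok Om v b -> folds_above (Om : set (R * R)) v b.
Proof.
move=> ok c /RleP bc z Oz /RleP zc; apply: (ok c) => //; exact: Rle_ge.
Qed.

Lemma lower_ok_folds Om v b : lower_ok Om v b ->
  folds_above (Om : set (R * R)) (- v.1, - v.2) (- b).
Proof.
move=> ok c bc z Oz zc.
rewrite reflection_opp; apply: (ok (- c)) => //; apply/RleP; first by rewrite lerNl.
by move: zc; rewrite /dotp /= !mulrN -opprD lerNr.
Qed.

Lemma sa_kernelE (h : R) x y : 0 < h -> sa_kernel h x y = kern h x y.
Proof.
move=> h0; rewrite /sa_kernel sqdistE RpowE.
have q0 := sq_dist_h_gt0 h0 y x.
rewrite kernC /kern /profile; set q := _ + _ in q0 *.
have -> : Rpower q (Rdiv 3 2) = q * Num.sqrt q.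
  rewrite (_ : Rdiv 3 2 = Rplus 1 (Rinv 2)); last by Lra.lra.
  by rewrite Rpower_plus Rpower_1 ?Rpower_sqrt ?RsqrtE//; apply/RltP.
by rewrite RdivE.
Qed.

Lemma grid_sumE Om (h : R) x n : 0 < h ->
  grid_sum Om (sa_kernel h x) n = grid_total (integrand h (Om : set (R * R)) x) n.
Proof.
move=> h0; rewrite /grid_sum /grid_total sum_f_R0E big_mkord; apply: eq_bigr => i _.
rewrite sum_f_R0E big_mkord; apply: eq_bigr => j _.
rewrite !INRE !RdivE sa_kernelE//; congr (_ * _ * _).
rewrite /indic indicE; case: ClassicalEpsilon.excluded_middle_informative => [Op|nOp].
  by rewrite mem_set.
by rewrite memNset.
Qed.

(** Limits of sequences are unique, so convergence of the grid sums turns the relation [solid_angle]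
    into a function. *)
Lemma solid_angleP Om (h : R) x (a : R) : 0 < h -> compact_set2 Om -> convex_set Om ->
  (exists x0, interior2 Om x0) ->
  solid_angle Om h x a <-> a = fine (angle h (Om : set (R * R)) x).
Proof.
move=> h0 [/closed_set2_closed cl /bounded_set2_le[M bd]] /convex_set_convex2 cv.
case=> x0 /interior2_interior Ox0.
have cvg : Un_cv (grid_sum Om (sa_kernel h x)) (fine (angle h (Om : set (R * R)) x)).
  move=> e /RltP e0; have [N NP] := grid_total_dist_lt h0 cl bd x cv Ox0 e0.
  by exists N => n /ssrnat.leP Nn; apply/RltP; rewrite RdistE grid_sumE//; exact: NP.
by split=> [cvga|->//]; exact: UL_sequence cvga cvg.
Qed.

(** * Solid angle centers and the minimal unfolded region *)

Section Centers.
Variables (Om : pt -> Prop) (h : R).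
Hypothesis h_gt0 : 0 < h.
Hypothesis cpt : compact_set2 Om.
Hypothesis cvx : convex_set Om.
Hypothesis int : exists x0, interior2 Om x0.
Let f x : R := fine (angle h (Om : set (R * R)) x).

Lemma solid_angle_centerP x : solid_angle_center Om h x <-> forall y, f y <= f x.
Proof.
have angleP z a := solid_angleP z a h_gt0 cpt cvx int.
split=> [[a [/angleP -> xmax]] y|xmax].
  by have /RleP := xmax y (f y) ((angleP y (f y)).2 erefl).
exists (f x); split; first exact: (angleP x (f x)).2.
by move=> y b /angleP ->; apply/RleP; exact: xmax.
Qed.

Lemma center_unfolded_region x : solid_angle_center Om h x -> unfolded_region Om x.
Proof.
have [/closed_set2_closed cl /bounded_set2_le[M bd]] := cpt.
have cv := convex_set_convex2 cvx; have [x0 /interior2_interior Ox0] := int.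
move=> /solid_angle_centerP xmax v v1; split=> b ok; apply/RleP.
  exact: (angle_max_unfolded h_gt0 cl cv bd Ox0 xmax v1 (upper_ok_folds ok)).
have v1' : dotp (- v.1, - v.2) (- v.1, - v.2) = 1 by rewrite /dotp /= !mulrNN.
have := angle_max_unfolded h_gt0 cl cv bd Ox0 xmax v1' (lower_ok_folds ok).
by rewrite {1}/dotp /= !mulrN -opprD lerN2.
Qed.

(** Squaring [h <= sqrt 2 * dist2 z w] gives exactly the inequality on boundary points that
    [disc_in_of_boundary] asks for. *)
Lemma unfolded_region_disc x :
  (forall z, unfolded_region Om z -> interior2 Om z) ->
  (forall z w, unfolded_region Om z -> boundary2 Om w ->
    Rle h (Rmult (sqrt (IZR 2)) (dist2 z w))) ->
  unfolded_region Om x -> disc_in (Om : set (R * R)) h x.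
Proof.
have [/closed_set2_closed cl /bounded_set2_le[M bd]] := cpt.
have cv := convex_set_convex2 cvx.
move=> uf_int uf_dist ufx.
have Ox : Om x by apply: interior_subset (interior2_interior (uf_int x ufx)).
apply: (disc_in_of_boundary cl cv bd Ox) => w Ow bdw.
have /(uf_dist _ _ ufx) : boundary2 Om w.
  move=> e /RltP e0; split.
    exists w; split=> //; apply/(dist2_lt w w e0).
    by rewrite /sq_dist !subrr expr0n addr0 exprn_gt0.
  by have [q [nq wq]] := bdw e e0; exists q; split=> //; apply/(dist2_lt w q e0).
move=> /RleP; rewrite /dist2 sqdistE !RsqrtE RmultE IZR2E => le.
have hle : h ^+ 2 <= (Num.sqrt 2 * Num.sqrt (sq_dist x w)) ^+ 2.
  by rewrite lerXn2r// nnegrE ?mulr_ge0 ?sqrtr_ge0// ltW.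
by apply: le_trans hle _; rewrite exprMn !sqr_sqrtr ?sq_dist_ge0.
Qed.
End Centers.
End StdlibReals.

Local Close Scope ring_scope.
Local Open Scope R_scope.

Theorem theorem4p9 (Om : pt -> Prop) (h : R) :
  compact_set2 Om -> convex_set Om -> (exists x : pt, interior2 Om x) ->
  (forall z, unfolded_region Om z -> interior2 Om z) ->
  0 < h ->
  (forall z w, unfolded_region Om z -> boundary2 Om w -> h <= sqrt 2 * dist2 z w) ->
  exists! x : pt, solid_angle_center Om h x.
Proof.
move=> cpt cvx int uf_int /RltP h_gt0 uf_dist.
have [/closed_set2_closed cl /bounded_set2_le[M bd]] := cpt.
have cv := convex_set_convex2 cvx; have [x0 /interior2_interior Ox0] := int.
have centerP z := solid_angle_centerP h_gt0 cpt cvx int z.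
have center_disc z : solid_angle_center Om h z -> disc_in Om h z.
  move=> /(center_unfolded_region h_gt0 cpt cvx int).
  by apply: (unfolded_region_disc h_gt0 cpt cvx).
have [x /centerP xc] := exists_angle_max h_gt0 cl bd Ox0.
exists x; split=> // y yc.
exact: (angle_max_unique h_gt0 cl cv bd ((centerP _).1 xc) ((centerP _).1 yc)
  (center_disc _ xc) (center_disc _ yc)).
Qed.
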